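(* Consider the elliptic curve $E: y^2=x^3+58x^2+1440x+12960$ over $\mathbb{Q}$. For a rational point $(x,y)$ on $E$ with $x\neq 0$, put $t=-(x+36)/x$ and $$n=3(t-1)(t+1)(t^2+2)(2t^2+1).$$ Then, when $n\ne 0$, $x_4=6(t-1)(t+1)(2t^2+1)^2$ is the $x$-coordinate of a rational point on the curve $Y^2=X^3-n^2X$. Moreover, in this way one obtains an infinite number of congruent number curves $Y^2=X^3-n^2X$ that have three linearly independent rational points.
   Context: A congruent number curve is an elliptic curve over $\mathbb{Q}$ of the form $Y^2=X^3-n^2X$ (with $n$ a nonzero rational number, which may be scaled to an integer). Points are linearly independent if no nontrivial integer linear combination of them is the identity in the Mordell–Weil group. *)

(* Defs.v *)
From mathcomp Require Import all_boot all_order all_algebra.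

Set Implicit Arguments.
Unset Strict Implicit.
Unset Printing Implicit Defensive.

Import GRing.Theory.
Local Open Scope ring_scope.

(* Y^2 = X^3 + a2 X^2 + a4 X + a6; in characteristic different from 2 every
   Weierstrass equation can be brought to this form. *)
Record wcurve (F : fieldType) := WCurve { a2 : F; a4 : F; a6 : F }.

Inductive point (F : fieldType) := Infty | Aff of F & F.
Arguments Infty {F}.

Section GroupLaw.
Variables (F : fieldType) (E : wcurve F).

Definition on_curve (P : point F) : bool :=
  if P is Aff x y then y ^+ 2 == x ^+ 3 + a2 E * x ^+ 2 + a4 E * x + a6 E
  else true.

Definition oppp (P : point F) : point F :=
  if P is Aff x y then Aff x (- y) else Infty.

(* The chord-and-tangent law. It is defined on all pairs of points, but it is
   only meaningful for points lying on E: two such points with the same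
   abscissa are either opposite or equal, whence the tangent slope. *)
Definition addp (P Q : point F) : point F :=
  match P, Q with
  | Infty, _ => Q
  | _, Infty => P
  | Aff x1 y1, Aff x2 y2 =>
      if (x1 == x2) && (y1 == - y2) then Infty else
      let l := if x1 == x2
               then (3 * x1 ^+ 2 + 2 * a2 E * x1 + a4 E) / (2 * y1)
               else (y2 - y1) / (x2 - x1) in
      let x3 := l ^+ 2 - a2 E - x1 - x2 in
      Aff x3 (l * (x1 - x3) - y1)
  end.

Definition mulpz (m : int) (P : point F) : point F :=
  match m with
  | Posz k => iter k (addp P) Infty
  | Negz k => oppp (iter k.+1 (addp P) Infty)
  end.

Definition lin_indep3 (P1 P2 P3 : point F) : Prop :=
  forall m1 m2 m3 : int,
    addp (addp (mulpz m1 P1) (mulpz m2 P2)) (mulpz m3 P3) = Infty ->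
    [/\ m1 = 0, m2 = 0 & m3 = 0].

Definition has_three_indep_points : Prop :=
  exists P1 P2 P3 : point F,
    [/\ on_curve P1, on_curve P2, on_curve P3 & lin_indep3 P1 P2 P3].

End GroupLaw.

(* Isomorphism over the base field F (not over its algebraic closure), i.e. an
   admissible change of variables X = u^2 X' + r, Y = u^3 Y' with u, r in F.
   The terms u^2 s X' + t of the general Y-substitution must vanish here, as
   neither equation contains the monomials XY and Y (characteristic not 2). *)
Definition wcurve_iso (F : fieldType) (E E' : wcurve F) : Prop :=
  exists u r : F,
    [/\ u != 0,
        u ^+ 2 * a2 E' = a2 E + 3 * r,
        u ^+ 4 * a4 E' = a4 E + 2 * r * a2 E + 3 * r ^+ 2 &
        u ^+ 6 * a6 E' = a6 E + r * a4 E + r ^+ 2 * a2 E + r ^+ 3].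

(* An elliptic curve exactly when n != 0. *)
Definition congruent_curve (n : rat) : wcurve rat := WCurve 0 (- n ^+ 2) 0.

Definition curveE : wcurve rat := WCurve 58 1440 12960.

Definition t_of (x : rat) : rat := - (x + 36) / x.

Definition n_of (t : rat) : rat :=
  3 * (t - 1) * (t + 1) * (t ^+ 2 + 2) * (2 * t ^+ 2 + 1).

Definition x4_of (t : rat) : rat :=
  6 * (t - 1) * (t + 1) * (2 * t ^+ 2 + 1) ^+ 2.

Definition arises_from_E (n : rat) : Prop :=
  exists x y : rat,
    [/\ on_curve curveE (Aff x y), x != 0 & n = n_of (t_of x)].

(* Main.v *)
Require Import Defs.
From HB Require Import structures.
From mathcomp Require Import all_boot all_order all_algebra.
From mathcomp Require Import ring lra zify.
Set Implicit Arguments.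
Unset Strict Implicit.
Unset Printing Implicit Defensive.
Import Order.TTheory GRing.Theory Num.Theory.
Local Open Scope ring_scope.

(** Write A = t^2 - 1, B = t^2 + 2, C = 2 t^2 + 1, so that n = 3 A B C. The curve
    Y^2 = X^3 - n^2 X carries, for every t, the points with abscissas 3 B^2 C and
    3 B C^2, and it carries a third one with abscissa x4 = 6 A C^2 as soon as
    2 A (5 t^2 + 4) is a square. The last condition is the equation of E: with
    t = -(x + 36)/x one has 2 A (5 t^2 + 4) = (36 y / x^2)^2.

    Independence is a 2-descent. For a root e of a cubic, P |-> x(P) - e is a
    homomorphism from the group of points to the rationals modulo squares
    ([chiD]). Points that stay independent of each other and of the 2-torsion
    modulo doubles are independent ([independent_of_mod2]); this uses that the
    points form a group ([addpA]). If the point of E is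
    the double of another one, A is twice a square, and if moreover it lies in the
    kernel of reduction modulo 2, then B and C have even 2-adic valuation. Signs and
    2-adic valuations then exclude all relations modulo doubles, except those
    which make B C a square ([three_independent_points]). But B C is a square
    only if t^2 = 1: from a square value of (t^2 + 2)(2 t^2 + 1) one gets
    U^2 + V^2 and U^2 + 4 V^2 both squares with U = t^4 - 1, and by Euler's infinite
    descent this forces U V = 0 ([euler_concordant], [quartic_not_square]).

    For infinitely many curves it is enough to find points of E with n > 0 such that no
    two of the values of n have a product that is a square, since isomorphic curves
    have n and n' with n n' or - n n' a square. As A is twice a square, n n' is a square
    exactly when (B C)(B' C') is. Now B C, not being a square, contains some prime p
    to an odd power. If the point giving B' C' reduces to the origin modulo p, then
    B' C' has even p-adic valuation, and the product is not a square. Such points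
    exist: by the pigeonhole principle, for every prime p some
    multiple of a fixed point gen, by some m <= p^2 + 1, reduces to the origin
    ([multiple_gen_in_ker]), so doubles of factorial-like multiples of gen do
    ([mult_seq]); and gen has infinite order ([gen_nontorsion]). All this is done
    on the translate Y^2 = X (X^2 + 4 X + 324) of E, where X = x + 18. *)

(** * The group law on a nonsingular cubic *)

Section PointChoice.
Variable F : fieldType.

Definition option_of_point (P : point F) : option (F * F) :=
  if P is Aff x y then Some (x, y) else None.
Definition point_of_option (o : option (F * F)) : point F :=
  if o is Some (x, y) then Aff x y else Infty.
Lemma option_of_pointK : cancel option_of_point point_of_option.
Proof. by case. Qed.

HB.instance Definition _ := Choice.copy (point F) (can_type option_of_pointK).

End PointChoice.

Section GroupLaw.
Variables (F : fieldType) (E : wcurve F).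

Definition cubic (x : F) : F := x ^+ 3 + a2 E * x ^+ 2 + a4 E * x + a6 E.
Definition dcubic (x : F) : F := 3 * x ^+ 2 + 2 * a2 E * x + a4 E.

Definition nonsingular : Prop :=
  (2 : F) != 0 /\ forall x, cubic x = 0 -> dcubic x != 0.

Definition slope (x1 y1 x2 y2 : F) : F :=
  if x1 == x2 then dcubic x1 / (2 * y1) else (y2 - y1) / (x2 - x1).

Lemma on_curveE x y : on_curve E (Aff x y) = (y ^+ 2 == cubic x).
Proof. by []. Qed.

Lemma addp_aff x1 y1 x2 y2 : ~~ ((x1 == x2) && (y1 == - y2)) ->
  let l := slope x1 y1 x2 y2 in
  let x3 := l ^+ 2 - a2 E - x1 - x2 in
  addp E (Aff x1 y1) (Aff x2 y2) = Aff x3 (l * (x1 - x3) - y1).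
Proof. by rewrite /addp /slope => /negbTE->. Qed.

Hypothesis ns : nonsingular.
Let two_neq0 : (2 : F) != 0. Proof. by case: ns. Qed.

Lemma sqr_cases (y z : F) : y ^+ 2 = z ^+ 2 -> y = z \/ y = - z.
Proof. by move/eqP; rewrite eqf_sqr => /orP[] /eqP; [left|right]. Qed.

Lemma same_abscissa x y1 y2 : y1 ^+ 2 = cubic x -> y2 ^+ 2 = cubic x ->
  y1 != - y2 -> y2 = y1 /\ y1 != 0.
Proof.
move=> h1 h2 ne.
have : y1 ^+ 2 = y2 ^+ 2 by rewrite h1 h2.
case/sqr_cases => h; last by rewrite h eqxx in ne.
split=> //; apply/eqP => y0; move: ne.
by rewrite -h y0 oppr0 eqxx.
Qed.

(** Vieta: on the line y = l x + c through two points, the cubic minus the square of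
    the line is the monic polynomial with the three abscissas as roots. Comparing
    coefficients covers chord and tangent at once, in any characteristic but 2. *)
Lemma secant_vieta x1 y1 x2 y2 :
  y1 ^+ 2 = cubic x1 -> y2 ^+ 2 = cubic x2 ->
  ~~ ((x1 == x2) && (y1 == - y2)) ->
  let l := slope x1 y1 x2 y2 in
  let x3 := l ^+ 2 - a2 E - x1 - x2 in
  exists c : F,
    [/\ y1 = l * x1 + c, y2 = l * x2 + c,
        a4 E = 2 * l * c + x1 * x2 + x1 * x3 + x2 * x3 &
        a6 E = c ^+ 2 - x1 * x2 * x3].
Proof.
rewrite /slope => h1 h2; case: eqVneq => [e|nx] /= ne.
  subst x2; have [-> y0] := same_abscissa h1 h2 ne.
  exists (y1 - dcubic x1 / (2 * y1) * x1).
  move: h1; rewrite /cubic /dcubic => h1.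
  have e6 : a6 E = y1 ^+ 2 - (x1 ^+ 3 + a2 E * x1 ^+ 2 + a4 E * x1).
    by rewrite h1; ring.
  by split; rewrite ?e6; field; rewrite y0.
have nx' : x2 - x1 != 0 by rewrite subr_eq0 eq_sym.
move: h1 h2; rewrite /cubic => h1 h2.
have e4 : a4 E = (y2 ^+ 2 - y1 ^+ 2 - (x2 ^+ 3 - x1 ^+ 3)
                  - a2 E * (x2 ^+ 2 - x1 ^+ 2)) / (x2 - x1).
  by rewrite h1 h2; field.
have e6 : a6 E = y1 ^+ 2 - (x1 ^+ 3 + a2 E * x1 ^+ 2 + a4 E * x1).
  by rewrite h1; ring.
exists (y1 - (y2 - y1) / (x2 - x1) * x1).
by split; rewrite ?e6 ?e4; field.
Qed.

Lemma addp_on P Q : on_curve E P -> on_curve E Q -> on_curve E (addp E P Q).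
Proof.
case: P Q => [|x1 y1] [|x2 y2] //; rewrite !on_curveE => /eqP h1 /eqP h2.
have [eq|ne] := boolP ((x1 == x2) && (y1 == - y2)); first by rewrite /addp eq.
have [c [e1 e2 e4 e6]] := secant_vieta h1 h2 ne.
rewrite addp_aff // on_curveE; move: (slope _ _ _ _) e1 e2 e4 e6 => l e1 _ e4 e6.
by apply/eqP; rewrite /cubic e4 e6 e1; ring.
Qed.

Lemma oppp_on P : on_curve E P -> on_curve E (oppp P).
Proof. by case: P => // x y; rewrite !on_curveE sqrrN. Qed.

Lemma slopeC x1 y1 x2 y2 :
  y1 ^+ 2 = cubic x1 -> y2 ^+ 2 = cubic x2 ->
  ~~ ((x1 == x2) && (y1 == - y2)) -> slope x2 y2 x1 y1 = slope x1 y1 x2 y2.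
Proof.
move=> h1 h2; rewrite /slope [x2 == _]eq_sym; case: eqVneq => [e|nx] /= ne.
  subst x2; by have [-> _] := same_abscissa h1 h2 ne.
have nx' : x2 - x1 != 0 by rewrite subr_eq0 eq_sym.
by rewrite -(opprB y1) -(opprB x1) invrN mulrNN.
Qed.

Lemma addpC P Q : on_curve E P -> on_curve E Q -> addp E P Q = addp E Q P.
Proof.
case: P Q => [|x1 y1] [|x2 y2] //; rewrite !on_curveE => /eqP h1 /eqP h2.
have eC : (x2 == x1) && (y2 == - y1) = (x1 == x2) && (y1 == - y2).
  by rewrite eq_sym -[y2 == _]eqr_oppLR [- y2 == _]eq_sym.
have [eq|ne] := boolP ((x1 == x2) && (y1 == - y2)).
  by rewrite /addp eC eq.
rewrite !addp_aff ?eC // (slopeC h1 h2 ne) /=.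
have [c [e1 e2 _ _]] := secant_vieta h1 h2 ne.
move: (slope _ _ _ _) e1 e2 => l -> ->.
by congr Aff; ring.
Qed.

Lemma add0p P : addp E Infty P = P. Proof. by []. Qed.
Lemma addp0 P : addp E P Infty = P. Proof. by case: P. Qed.

Lemma opppK P : oppp (oppp P) = P :> point F.
Proof. by case: P => //= x y; rewrite opprK. Qed.

Lemma addNp P : addp E (oppp P) P = Infty.
Proof. by case: P => //= x y; rewrite !eqxx. Qed.

(** A line meeting the cubic twice at (x, y) is the tangent there. A vertical tangent
    with y = 0 is what nonsingularity forbids. *)
Lemma tangent_slope x y l c x1 :
  y ^+ 2 = cubic x -> y = l * x + c ->
  a2 E = l ^+ 2 - x1 - x - x ->
  a4 E = 2 * l * c + x1 * x + x1 * x + x * x ->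
  y != 0 /\ dcubic x / (2 * y) = l.
Proof.
move=> h ey e2 e4.
have ed : dcubic x = 2 * y * l.
  by rewrite /dcubic e2 e4 ey; ring.
have y0 : y != 0.
  apply/eqP => y0; case: ns => _ /(_ x); rewrite -h y0 expr0n /= ed y0.
  by move=> /(_ erefl); rewrite mulr0 mul0r eqxx.
by split=> //; rewrite ed; field; rewrite y0.
Qed.

(** The line through P + Q and - Q is the reflection of the line PQ; when these two
    points coincide, it is the tangent there. *)
Lemma addpK P Q : on_curve E P -> on_curve E Q ->
  addp E (addp E P Q) (oppp Q) = P.
Proof.
case: P Q => [|x1 y1] [|x2 y2] //; first by move=> _ _; rewrite /= opprK !eqxx.
rewrite !on_curveE => /eqP h1 /eqP h2.
have [eq|ne] := boolP ((x1 == x2) && (y1 == - y2)).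
  rewrite {2}/addp eq add0p /=.
  by case/andP: eq => /eqP-> /eqP->.
have [c [e1 e2 e4 e6]] := secant_vieta h1 h2 ne.
rewrite (addp_aff ne); move: (slope _ _ _ _) e1 e2 e4 e6 => l e1 e2 e4 e6.
set x3 := l ^+ 2 - a2 E - x1 - x2 in e4 e6 *.
have ea2 : a2 E = l ^+ 2 - x1 - x2 - x3 by rewrite /x3; ring.
have ne3 : ~~ ((x3 == x2) && (l * (x1 - x3) - y1 == - - y2)) /\
           slope x3 (l * (x1 - x3) - y1) x2 (- y2) = - l.
  rewrite /slope; case: eqVneq => [e|nx] /=; last first.
    have nx' : x2 - x3 != 0 by rewrite subr_eq0 eq_sym.
    by split=> //; rewrite e1 e2; field.
  rewrite e in e4 ea2 *.
  have e4' : a4 E = 2 * l * c + x1 * x2 + x1 * x2 + x2 * x2 by [].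
  have [y0 sl] := tangent_slope h2 e2 (etrans ea2 (addrAC _ _ _)) e4'.
  have -> : l * (x1 - x2) - y1 = - y2 by rewrite e1 e2; ring.
  split; last by rewrite mulrN invrN mulrN sl.
  by rewrite opprK -subr_eq0 -opprD oppr_eq0 -mulr2n -mulr_natl mulf_neq0.
case: ne3 => ne3 sl; rewrite [oppp _]/oppp (addp_aff ne3) sl.
by congr Aff; rewrite /x3 ?e1; ring.
Qed.

(** With l the slope of PQ and mu the second divided difference of the ordinates on
    P, Q, R, the abscissa of P + Q is x3 - mu (y3 + l x3 + c); hence the slope of the
    line through P + Q and R is 1 / mu - l, also when it is a tangent. The resulting
    sum is symmetric in P and R, since l - l' = mu (x1 - x3) for the slope l' of QR. *)
Lemma addp3E x1 y1 x2 y2 x3 y3 :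
  y1 ^+ 2 = cubic x1 -> y2 ^+ 2 = cubic x2 -> y3 ^+ 2 = cubic x3 ->
  ~~ ((x1 == x2) && (y1 == - y2)) -> ~~ ((x2 == x3) && (y2 == - y3)) ->
  x1 != x3 ->
  let l := slope x1 y1 x2 y2 in
  let mu := (slope x2 y2 x3 y3 - l) / (x3 - x1) in
  let x4 := (mu^-1 - l) ^+ 2 - l ^+ 2 + x1 + x2 - x3 in
  addp E (Aff x1 y1) (Aff x2 y2) != oppp (Aff x3 y3) ->
  mu != 0 /\
  addp E (addp E (Aff x1 y1) (Aff x2 y2)) (Aff x3 y3) =
  Aff x4 ((mu^-1 - l) * (x3 - x4) - y3).
Proof.
move=> h1 h2 h3 ne12 ne23 ne13; cbv zeta.
have n31 : x3 - x1 != 0 by rewrite subr_eq0 eq_sym.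
have [c [e1 e2 e4 e6]] := secant_vieta h1 h2 ne12.
have [c2 [e2' e3' _ _]] := secant_vieta h2 h3 ne23.
rewrite (addp_aff ne12).
have tan2 : x2 = x3 -> y3 = y2 /\
              2 * y2 * slope x2 y2 x3 y3 = dcubic x2.
  move=> e; move: ne23 h3; rewrite /slope -e eqxx /= => ne h3.
  have [-> y0] := same_abscissa h2 h3 ne; split=> //.
  by field; rewrite y0.
move: (slope x1 y1 x2 y2) (slope x2 y2 x3 y3) e1 e2 e4 e6 e2' e3' tan2
  => l l2 e1 e2 e4 e6 e2' e3' tan2.
set xs := l ^+ 2 - a2 E - x1 - x2 in e4 e6 *.
have ea2 : a2 E = l ^+ 2 - x1 - x2 - xs by rewrite /xs; ring.
set mu := (l2 - l) / (x3 - x1); set d := l * x3 + c.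
have emu : l2 = l + mu * (x3 - x1) by rewrite /mu; field.
have edif : y3 - d = mu * (x3 - x1) * (x3 - x2).
  have -> : y3 - d = y3 - y2 - l * (x3 - x2) by rewrite /d e2; ring.
  by rewrite e3' e2' emu; ring.
(* Leibniz rule for divided differences, applied to the square of the ordinate. *)
have key : mu * (y3 + d) = x3 - xs.
  have [e|ne] := eqVneq x2 x3.
    have [ey] := tan2 e; rewrite emu /dcubic ea2 e4 => ed.
    apply: (mulfI n31); move: ed; rewrite /d ey -e -e2 e2 => ed.
    apply: (addrI (2 * (l * x2 + c) * l)).
    transitivity (2 * (l * x2 + c) * (l + mu * (x2 - x1))); first by ring.
    by rewrite ed; ring.
  have n32 : x3 - x2 != 0 by rewrite subr_eq0 eq_sym.
  apply: (mulfI (mulf_neq0 n31 n32)).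
  transitivity ((y3 - d) * (y3 + d)); first by rewrite edif; ring.
  transitivity (y3 ^+ 2 - d ^+ 2); first by ring.
  by rewrite h3 /cubic ea2 e4 e6 /d; ring.
move=> nS.
have [mu0 [neS slS]] : mu != 0 /\
   (~~ ((xs == x3) && (l * (x1 - xs) - y1 == - y3)) /\
    slope xs (l * (x1 - xs) - y1) x3 y3 = mu^-1 - l).
  have -> : l * (x1 - xs) - y1 = - (l * xs + c) by rewrite e1; ring.
  rewrite /slope; case: (eqVneq xs x3) => [e|ne] /=; last first.
    have ne' : x3 - xs != 0 by rewrite subr_eq0 eq_sym.
    have mu0 : mu != 0 by apply: contraNneq ne' => e; rewrite -key e mul0r.
    split=> //; split=> //.
    have -> : y3 - - (l * xs + c) = (y3 + d) - l * (x3 - xs) by rewrite /d; ring.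
    rewrite mulrBl mulfK // -key; move: ne'; rewrite -key mulf_eq0 negb_or.
    by case/andP=> _ yd0; field; rewrite mu0 yd0.
  have nyd : - (l * xs + c) != - y3.
    by apply: contra nS => /eqP ey; rewrite e /= -ey e1; apply/eqP; congr Aff; rewrite e; ring.
  have ed : y3 = - d.
    have : y3 ^+ 2 = d ^+ 2.
      by rewrite h3 /cubic ea2 e4 e6 /d e; ring.
    by case/sqr_cases => // ey; rewrite e -/d ey eqxx in nyd.
  have y0 : y3 != 0.
    by apply: contraNneq nyd => y0; rewrite e -/d -ed y0 oppr0.
  have edif2 : 2 * y3 = mu * (x3 - x1) * (x3 - x2) by rewrite -edif ed; ring.
  have mu0 : mu != 0.
    by apply: contraNneq (mulf_neq0 two_neq0 y0) => m0; rewrite edif2 m0 !mul0r.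
  split=> //; split=> //.
  have -> : dcubic xs = 2 * d * l + (x3 - x1) * (x3 - x2).
    by rewrite /dcubic ea2 e4 /d e; ring.
  have -> : (x3 - x1) * (x3 - x2) = 2 * y3 / mu by rewrite edif2; field.
  by rewrite e -/d -ed -[d]opprK -ed; field; rewrite mu0 y0.
split=> //; rewrite (addp_aff neS) slS.
have -> : (mu^-1 - l) ^+ 2 - a2 E - xs - x3 =
          (mu^-1 - l) ^+ 2 - l ^+ 2 + x1 + x2 - x3 by rewrite ea2; ring.
congr Aff.
have hs : y3 + d = (x3 - xs) / mu by rewrite -key; field.
have -> : y1 = l * x1 + c by [].
have -> : y3 = (x3 - xs) / mu - d by rewrite -hs; ring.
by rewrite /d; field.
Qed.

Lemma opppD P Q : on_curve E P -> on_curve E Q ->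
  oppp (addp E P Q) = addp E (oppp P) (oppp Q).
Proof.
case: P Q => [|x1 y1] [|x2 y2] //; rewrite !on_curveE => /eqP h1 /eqP h2.
have [eq|ne] := boolP ((x1 == x2) && (y1 == - y2)).
  by move: eq; rewrite /addp /= eqr_opp => ->.
have ne' : ~~ ((x1 == x2) && (- y1 == - - y2)) by rewrite eqr_opp.
rewrite [oppp (Aff x1 y1)]/oppp [oppp (Aff x2 y2)]/oppp.
rewrite (addp_aff ne) (addp_aff ne').
have -> : slope x1 (- y1) x2 (- y2) = - slope x1 y1 x2 y2.
  rewrite /slope; case: ifP => _; last by rewrite -opprD mulNr.
  by rewrite mulrN invrN mulrN.
by rewrite /= sqrrN; congr Aff; ring.
Qed.

(** Away from x(P) = x(R) and from opposite pairs this is the symmetry of [addp3E]; the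
    remaining cases follow from commutativity and the cancellation [addpK]. *)
Lemma addpA P Q R : on_curve E P -> on_curve E Q -> on_curve E R ->
  addp E P (addp E Q R) = addp E (addp E P Q) R.
Proof.
case: P => [|x1 y1]; first by [].
case: Q => [|x2 y2]; first by [].
case: R => [|x3 y3]; first by rewrite !addp0.
set P := Aff x1 y1; set Q := Aff x2 y2; set R := Aff x3 y3 => hP hQ hR.
have hPQ := addp_on hP hQ; have hQR := addp_on hQ hR.
have onN := oppp_on.
have [e|nPQR] := eqVneq (addp E P Q) (oppp R).
  have eP : P = addp E (oppp R) (oppp Q) by rewrite -e addpK.
  rewrite e addNp eP -opppD // [addp E R Q]addpC //.
  by rewrite addNp.
have [e|nRQP] := eqVneq (addp E R Q) (oppp P).
  case/eqP: nPQR; have -> : R = addp E (oppp P) (oppp Q) by rewrite -e addpK.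
  by rewrite -opppD // opppK.
have [e|n13] := eqVneq x1 x3.
  move: (hP) (hR); rewrite !on_curveE e => /eqP h1 /eqP h3.
  have [ey|ey] : y1 = y3 \/ y1 = - y3 by apply: sqr_cases; rewrite h1 h3.
    have -> : R = P by rewrite /R /P e ey.
    by rewrite [RHS]addpC // [addp E P Q]addpC.
  have -> : R = oppp P by rewrite /R /P /= e ey opprK.
  rewrite [addp E P Q]addpC // addpK //.
  by rewrite addpC ?addp_on ?oppp_on // -{2}[P]opppK addpK ?oppp_on.
have [e|ne12] := boolP ((x1 == x2) && (y1 == - y2)).
  have -> : P = oppp Q by case/andP: e => /eqP e1 /eqP e2; rewrite /P /Q e1 e2.
  by rewrite addNp addpC ?addp_on ?oppp_on // [addp E Q R]addpC // addpK.
have [e|ne23] := boolP ((x2 == x3) && (y2 == - y3)).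
  have -> : R = oppp Q.
    by case/andP: e => /eqP e1 /eqP e2; rewrite /R /Q /= e1 e2 opprK.
  by rewrite addpK // [addp E Q _]addpC ?oppp_on // addNp addp0.
move: (hP) (hQ) (hR); rewrite !on_curveE => /eqP h1 /eqP h2 /eqP h3.
have nC x y x' y' : ((x == x') && (y == - y')) = ((x' == x) && (y' == - y)) :> bool.
  by rewrite [x == _]eq_sym -[y == _]eqr_oppLR [- y == _]eq_sym.
have ne32 := ne23; rewrite nC in ne32.
have ne21 := ne12; rewrite nC in ne21.
have n31 : x3 != x1 by rewrite eq_sym.
have [mu0 ->] := addp3E h1 h2 h3 ne12 ne23 n13 nPQR.
rewrite [LHS]addpC // [addp E Q R]addpC //.
have [_ ->] := addp3E h3 h2 h1 ne32 ne21 n31 nRQP.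
rewrite (slopeC h2 h3 ne23) (slopeC h1 h2 ne12).
have [c [e1 e2 _ _]] := secant_vieta h1 h2 ne12.
have [c2 [e2' e3' _ _]] := secant_vieta h2 h3 ne23.
move: (slope x1 y1 x2 y2) (slope x2 y2 x3 y3) e1 e2 e2' e3' mu0
  => l l2 e1 e2 e2' e3' mu0.
have d13 : x3 - x1 != 0 by rewrite subr_eq0.
have -> : (l - l2) / (x1 - x3) = (l2 - l) / (x3 - x1).
  by rewrite -(opprB l2) -(opprB x3) invrN mulrNN.
set mu := (l2 - l) / (x3 - x1) in mu0 *.
have e : l2 = l + mu * (x3 - x1) by rewrite /mu; field.
have ey : y3 = y1 + l * (x2 - x1) + l2 * (x3 - x2).
  transitivity (y1 + (y2 - y1) + (y3 - y2)); first by ring.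
  by rewrite {2}e2' e3' {2}e1 e2; ring.
by rewrite ey e; congr Aff; field.
Qed.

End GroupLaw.

(** Bundling the curve with its nonsingularity lets its points be a zmodType. *)
Record ecurve (F : fieldType) :=
  ECurve { ecurve_val :> wcurve F; ecurveP : nonsingular ecurve_val }.

Record ecpoint (F : fieldType) (E : ecurve F) :=
  ECPoint { pt :> point F; ptP : on_curve E pt }.

HB.instance Definition _ F E := [isSub for @pt F E].
HB.instance Definition _ F (E : ecurve F) := [Choice of ecpoint E by <:].

Section EcGroup.
Variables (F : fieldType) (E : ecurve F).
Implicit Types P Q R : ecpoint E.

Definition ecadd P Q := ECPoint (addp_on (ecurveP E) (ptP P) (ptP Q)).
Definition ecopp P := ECPoint (oppp_on (ptP P)).
Definition ecO : ecpoint E := @ECPoint F E Infty isT.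

Lemma ecaddA : associative ecadd.
Proof. by move=> P Q R; apply/val_inj/(addpA (ecurveP E)); apply: ptP. Qed.
Lemma ecaddC : commutative ecadd.
Proof. by move=> P Q; apply/val_inj/(addpC (ecurveP E)); apply: ptP. Qed.
Lemma ecadd0 : left_id ecO ecadd.
Proof. by move=> P; apply/val_inj. Qed.
Lemma ecaddN : left_inverse ecO ecopp ecadd.
Proof. by move=> P; apply/val_inj/addNp. Qed.

HB.instance Definition _ := GRing.isZmodule.Build (ecpoint E)
  ecaddA ecaddC ecadd0 ecaddN.

Lemma ptD P Q : pt (P + Q) = addp E (pt P) (pt Q). Proof. by []. Qed.
Lemma ptN P : pt (- P) = oppp (pt P). Proof. by []. Qed.
Lemma pt_mulz P (m : int) : pt (P *~ m) = Defs.mulpz E m (pt P).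
Proof.
have iterE k : pt (P *+ k) = iter k (addp E (pt P)) Infty.
  by elim: k => //= k <-; rewrite mulrS.
by case: m => k; rewrite ?NegzE ?mulrNz -?pmulrn /= -?iterE -?ptD -?mulrS.
Qed.

End EcGroup.

(** * Two-descent: the characters of the group of points *)

Section Squares.
Variable F : fieldType.
Implicit Types a b c : F.

Definition nzsqr (q : F) := exists2 z : F, z != 0 & q = z ^+ 2.

Lemma nzsqrM a b : nzsqr a -> nzsqr b -> nzsqr (a * b).
Proof.
by move=> [y y0 ->] [z z0 ->]; exists (y * z); rewrite ?mulf_neq0 // exprMn.
Qed.

Lemma nzsqr_sqr a : a != 0 -> nzsqr (a ^+ 2). Proof. by exists a. Qed.

Lemma nzsqr_cancel a b : nzsqr (a * b ^+ 2) -> b != 0 -> nzsqr a.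
Proof.
move=> [z z0 e] b0; exists (z / b); first by rewrite mulf_neq0 ?invr_eq0.
by rewrite expr_div_n -e mulfK // expf_neq0.
Qed.

End Squares.

Section Character.
Variables (F : fieldType) (E : ecurve F) (e : F).
Hypothesis e_root : cubic E e = 0.
Implicit Types P Q : ecpoint E.

(** The character x - e, with its value at the 2-torsion point (e, 0) dictated by
    multiplicativity: x - e is y^2 divided by the other factor of the cubic, and
    the value of that factor at e is dcubic e. *)
Definition chi (P : point F) : F :=
  if P is Aff x _ then if x == e then dcubic E e else x - e else 1.

Let d0 : dcubic E e != 0. Proof. by case: (ecurveP E) => _ /(_ e e_root). Qed.

Lemma chi_neq0 (P : point F) : chi P != 0.
Proof. by case: P => [|x y] /=; rewrite ?oner_eq0 //; case: ifPn; rewrite ?subr_eq0. Qed.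

(** At x = e the cubic vanishes, so that Vieta on the line y = l x + c reads
    (x1 - e)(x2 - e)(x3 - e) = (l e + c)^2; here m = l e + c. If one of the abscissas
    is e then m = 0, and D is the product of the other two factors. *)
Lemma chi_collinear x1 x2 x3 m l D (c := fun x => if x == e then D else x - e) :
  D != 0 -> (x1 - e) * (x2 - e) * (x3 - e) = m ^+ 2 ->
  D = m * l + (e - x1) * (e - x2) + (e - x1) * (e - x3) + (e - x2) * (e - x3) ->
  nzsqr (c x3 * (c x1 * c x2)).
Proof.
rewrite {}/c => D0 em eD.
have m0 x : x = e -> (x - e == 0) by move->; rewrite subrr.
have [e1|n1] := eqVneq x1 e; [|have [e2|n2] := eqVneq x2 e];
  [| |have [e3|n3] := eqVneq x3 e]; last first.
- have k1 : x1 - e != 0 by rewrite subr_eq0.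
  have k2 : x2 - e != 0 by rewrite subr_eq0.
  have k3 : x3 - e != 0 by rewrite subr_eq0.
  exists m; last by rewrite -em; ring.
  by rewrite -sqrf_eq0 -em !mulf_neq0.
- have mz : m = 0 by apply/eqP; rewrite -sqrf_eq0 -em e3 subrr mulr0.
  have -> : D = (x1 - e) * (x2 - e) by rewrite eD mz e3; ring.
  exists ((x1 - e) * (x2 - e)); last by ring.
  by rewrite mulf_neq0 // subr_eq0.
- have mz : m = 0 by apply/eqP; rewrite -sqrf_eq0 -em e2 subrr mulr0 mul0r.
  have eD' : D = (x1 - e) * (x3 - e) by rewrite eD mz e2; ring.
  move: D0; rewrite eD' mulf_eq0 negb_or => /andP[_ k3].
  move: (k3); rewrite subr_eq0 => /negbTE ->.
  exists ((x1 - e) * (x3 - e)); last by ring.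
  by rewrite mulf_neq0 // subr_eq0.
- have mz : m = 0 by apply/eqP; rewrite -sqrf_eq0 -em e1 subrr !mul0r.
  have eD' : D = (x2 - e) * (x3 - e) by rewrite eD mz e1; ring.
  move: D0; rewrite eD' mulf_eq0 negb_or => /andP[k2 k3].
  move: (k3) (k2); rewrite !subr_eq0 => /negbTE -> /negbTE ->.
  exists ((x2 - e) * (x3 - e)); last by ring.
  by rewrite mulf_neq0.
Qed.

Lemma chi_addp (P Q : point F) : on_curve E P -> on_curve E Q ->
  nzsqr (chi (addp E P Q) * (chi P * chi Q)).
Proof.
case: P => [|x1 y1]; first by rewrite add0p mul1r -expr2; move=> *; apply/nzsqr_sqr/chi_neq0.
case: Q => [|x2 y2]; first by rewrite addp0 mulr1 -expr2; move=> *; apply/nzsqr_sqr/chi_neq0.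
move=> h1 h2.
have [eq|ne] := boolP ((x1 == x2) && (y1 == - y2)).
  rewrite [addp _ _ _]/addp eq mul1r; case/andP: eq => /eqP-> _.
  by rewrite -expr2; apply: nzsqr_sqr; apply: chi_neq0 (Aff x2 y2).
move: h1 h2 => /eqP h1 /eqP h2.
have [c [e1 e2 e4 e6]] := secant_vieta (ecurveP E) h1 h2 ne.
rewrite (addp_aff _ ne).
move: (slope _ _ _ _ _) e1 e2 e4 e6 => l _ _ e4 e6.
set x3 := l ^+ 2 - a2 E - x1 - x2 in e4 e6 *.
have ea2 : a2 E = l ^+ 2 - x1 - x2 - x3 by rewrite /x3; ring.
apply: (@chi_collinear x1 x2 x3 (l * e + c) (2 * l)) => //.
  have -> : (x1 - e) * (x2 - e) * (x3 - e) = (l * e + c) ^+ 2 - cubic E e.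
    by rewrite /cubic ea2 e4 e6; ring.
  by rewrite e_root subr0.
by rewrite /dcubic ea2 e4; ring.
Qed.

Lemma chiD P Q : nzsqr (chi (pt (P + Q)) * (chi (pt P) * chi (pt Q))).
Proof. by apply: chi_addp; apply: ptP. Qed.

Lemma chi_double P : nzsqr (chi (pt (P + P))).
Proof. by apply: nzsqr_cancel (chi_neq0 P); rewrite expr2; apply: chiD. Qed.

End Character.

(** Halve a relation as long as possible. If it is not divisible by 2 it contradicts the
    hypothesis; if it is, its half holds up to a point annihilated by 2, which is
    why such a T is carried along. *)
Lemma independent_of_mod2 (V : zmodType) (P1 P2 P3 : V) :
  (forall (r1 r2 r3 : bool) (T S : V), T *+ 2 = 0 ->
     P1 *+ r1 + P2 *+ r2 + P3 *+ r3 + T = S *+ 2 ->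
     [/\ r1 = false, r2 = false, r3 = false & T = 0]) ->
  forall m1 m2 m3 : int, P1 *~ m1 + P2 *~ m2 + P3 *~ m3 = 0 ->
  [/\ m1 = 0, m2 = 0 & m3 = 0].
Proof.
move=> H.
suff main N (m1 m2 m3 : int) T : (`|m1| + `|m2| + `|m3| < N)%N -> T *+ 2 = 0 ->
    P1 *~ m1 + P2 *~ m2 + P3 *~ m3 + T = 0 -> [/\ m1 = 0, m2 = 0 & m3 = 0].
  move=> m1 m2 m3 e; apply: (main (`|m1| + `|m2| + `|m3|).+1 m1 m2 m3 0) => //.
    by rewrite mul0rn.
  by rewrite addr0.
elim: N m1 m2 m3 T => // N IH m1 m2 m3 T leN T2 e.
have half (m : int) : exists (q : int) (r : bool), m = q * 2 + r%:Z.
  exists (m %/ 2)%Z; exists ((m %% 2)%Z == 1).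
  have := divz_eq m 2; have := modz_ge0 m (isT : 2 != 0 :> int).
  have := ltz_pmod m (isT : 0 < 2 :> int); case: eqP; lia.
have [q1 [r1 em1]] := half m1; have [q2 [r2 em2]] := half m2.
have [q3 [r3 em3]] := half m3.
pose S := P1 *~ q1 + P2 *~ q2 + P3 *~ q3.
have mE (P : V) (q : int) (r : bool) : P *~ (q * 2 + r%:Z) = P *~ q *+ 2 + P *+ r.
  by rewrite mulrzDr mulrzA -!pmulrn.
have eS : P1 *+ r1 + P2 *+ r2 + P3 *+ r3 + T = (- S) *+ 2.
  apply/eqP; rewrite -subr_eq0 -mulNrn opprK; apply/eqP; rewrite -[RHS]e.
  rewrite em1 em2 em3 !mE /S !mulrnDl.
  rewrite [LHS]addrAC; congr (_ + _); rewrite addrACA [X in X + _ = _]addrACA.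
  by congr (_ + _ + _); apply: addrC.
have [z1 z2 z3 z4] := H _ _ _ _ _ T2 eS.
subst r1 r2 r3; rewrite !addr0 in em1 em2 em3.
have S2 : (- S) *+ 2 = 0 by rewrite -eS z4 !mulr0n !addr0.
have [m0|mn0] := eqVneq (`|m1| + `|m2| + `|m3|)%N 0%N; first by split; lia.
have [||k1 k2 k3] := IH q1 q2 q3 (- S) _ S2; [lia|by rewrite -/S subrr|].
by rewrite em1 em2 em3 k1 k2 k3.
Qed.

(** * Euler: u^2 + x^2 and u^2 + 4 x^2 are not both squares *)

Section EulerDescent.
Local Open Scope nat_scope.

Lemma even_logn_sqr n : (forall p, prime p -> ~~ odd (logn p n)) ->
  exists r, n = r ^ 2.
Proof.
case: (posnP n) => [-> _|n0 H]; first by exists 0.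
exists (\prod_(0 <= p < n.+1) p ^ (logn p n)./2).
rewrite -[LHS]partnT // /partn expnE /= big_mkcond /= -big_split /=.
apply: eq_bigr => p _; rewrite -expnD addnn.
have [pp|npp] := boolP (prime p); last by rewrite lognE (negPf npp).
by rewrite -[LHS](congr1 _ (odd_double_half _)) (negPf (H p pp)).
Qed.

Lemma coprime_of_primes a b : (forall p, prime p -> p %| a -> p %| b -> False) ->
  coprime a b.
Proof.
move=> H; rewrite /coprime; apply/eqP/eqP; apply: contraT => g1.
case: (posnP (gcdn a b)) => [g0|g0].
  have : ~~ (0 < gcdn a b) by rewrite g0.
  rewrite gcdn_gt0 negb_or -!eqn0Ngt => /andP[/eqP a0 /eqP b0].
  by case: (H 2) => //; rewrite ?a0 ?b0.
have pp : prime (pdiv (gcdn a b)) by apply: pdiv_prime; lia.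
have pd := pdiv_dvd (gcdn a b).
by case: (H _ pp); apply: dvdn_trans pd _; rewrite ?dvdn_gcdl ?dvdn_gcdr.
Qed.

Lemma coprime_sqr_factor a b c : coprime a b -> a * b = c ^ 2 -> exists r, a = r ^ 2.
Proof.
move=> co e; apply: even_logn_sqr => p pp.
have [a0|a0] := posnP a; first by rewrite a0 logn0.
have [b0|b0] := posnP b.
  by move: co; rewrite b0 /coprime gcdn0 => /eqP ->; rewrite logn1.
have := congr1 (logn p) e; rewrite lognM // lognX.
have [pa|npa] := boolP (p %| a); last first.
  by rewrite lognE pp a0 (negPf npa).
have npb : ~~ (p %| b).
  by apply/negP => pb; have := dvdn_gcd p a b; rewrite pa pb (eqP co) dvdn1; case: eqP pp => // ->.
rewrite [logn p b]lognE pp b0 (negPf npb) addn0 => ->.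
by rewrite mul2n odd_double.
Qed.

Lemma coprime_sqr_factors a b c : coprime a b -> a * b = c ^ 2 ->
  exists r s, [/\ a = r ^ 2, b = s ^ 2, c = r * s & coprime r s].
Proof.
move=> co e; have [r er] := coprime_sqr_factor co e.
have [s es] : exists s, b = s ^ 2.
  by apply: (@coprime_sqr_factor b a c); rewrite 1?coprime_sym // mulnC.
exists r; exists s; split=> //.
  by apply/eqP; rewrite -(eqn_exp2r _ _ (isT : 0 < 2)) -e er es expnMn.
by move: co; rewrite er es coprime_pexpl // coprime_pexpr.
Qed.

Lemma coprime_pow4_factors a b c : coprime a b -> a * b = c ^ 4 ->
  exists r s, [/\ a = r ^ 4, b = s ^ 4, c = r * s & coprime r s].
Proof.
move=> co e; have [|r [s [-> -> e2 co2]]] := @coprime_sqr_factors a b (c ^ 2) co.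
  by rewrite e -expnM.
have [k [l [-> -> ec co3]]] := coprime_sqr_factors co2 (esym e2).
by exists k; exists l; rewrite -!expnM.
Qed.

Lemma odd_sqr n : odd n -> exists k, n ^ 2 = 4 * k + 1.
Proof. by move=> on; exists ((n./2) * (n./2).+1); have := odd_double_half n; rewrite on; nia. Qed.

Lemma coprime_shift k g h : odd k -> coprime g h ->
  (forall l, l %| k -> l %| g -> l %| h ^ 2) -> coprime k (k + 4 * g ^ 2).
Proof.
move=> ok co H; apply: coprime_of_primes => l pl lk.
rewrite dvdn_addr // Euclid_dvdM // => /orP[].
  rewrite (_ : 4 = 2 ^ 2) // Euclid_dvdX // dvdn_prime2 // andbT => /eqP l2.
  by move: lk; rewrite l2 dvdn2 ok.
rewrite Euclid_dvdX // => /andP[lg _].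
have := H l lk lg; rewrite Euclid_dvdX // => /andP[lh _].
by have := dvdn_gcd l g h; rewrite lg lh (eqP co) dvdn1; case: eqP pl => // ->.
Qed.

(** P = (B - 12 A)(B - 16 A): both factors have the same sign. *)
Lemma descent_factor A B P : 0 < P -> P + 28 * (A * B) = 192 * A ^ 2 + B ^ 2 ->
  (exists2 z, B = z + 16 * A & z * (z + 4 * A) = P) \/
  (exists2 k, 12 * A = k + B & k * (k + 4 * A) = P).
Proof.
move=> P0 e; have [le16|lt16] := leqP (16 * A) B.
  left; exists (B - 16 * A); first lia.
  have [z ez] : exists z, B = z + 16 * A by exists (B - 16 * A); lia.
  by subst B; rewrite addnK; lia.
have [le12|lt12] := leqP (12 * A) B.
  have [m em] : exists m, B = m + 12 * A by exists (B - 12 * A); lia.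
  subst B; have h : m * m <= 4 * A * m by rewrite leq_mul2r; lia.
  by lia.
right; exists (12 * A - B); first lia.
have [k ek] : exists k, 12 * A = k + B by exists (12 * A - B); lia.
rewrite ek addnK.
have e2 : k * (k + 4 * A) + 28 * (A * B) = 192 * A ^ 2 + B ^ 2.
  have -> : k = 12 * A - B by lia.
  by nia.
by lia.
Qed.

(** Here a b = 192 g^4 splits into coprime factors, 64 g1^4 times g2^4 with a factor 3 on
    one side. If 3 goes with g2 there is a contradiction modulo 4; otherwise
    p^2 = (g2^2 - 12 g1^2)(g2^2 - 16 g1^2), whose factors are squares up to sign, and
    the negative sign is impossible modulo 4. *)
Lemma descent_step a b p g :
  odd p -> 0 < g -> coprime a b -> ~~ odd a ->
  a + b = p ^ 2 + 28 * g ^ 2 -> a * b = 192 * g ^ 4 ->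
  exists g1 g2 u y, [/\ g = g1 * g2, odd g2,
     u ^ 2 + 16 * g1 ^ 2 = g2 ^ 2 & u ^ 2 + 4 * g1 ^ 2 = y ^ 2].
Proof.
move=> op g0 coab ea eX eab.
have ob : odd b.
  have : odd (a + b) by rewrite eX oddD oddX op oddM.
  by rewrite oddD (negPf ea).
have p0 : 0 < p by case: (p) op.
have : 64 %| a.
  have co64 : coprime 64 b by apply: (@coprimeXl 6 2 b); rewrite coprime2n.
  by rewrite -(Gauss_dvdl _ co64) eab; apply/dvdnP; exists (3 * g ^ 4); lia.
case/dvdnP=> a' ea'; move: eab; rewrite {}ea' in ea coab eX *.
have {coab} coab : coprime a' b by apply: coprime_dvdl coab; apply: dvdn_mulr.
move=> eab; have {eab} eab : a' * b = 3 * g ^ 4 by lia.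
have : 3 %| a' * b by rewrite eab dvdn_mulr.
rewrite Euclid_dvdM // => /orP[/dvdnP[a'' e3]|/dvdnP[b' e3]].
  have co2 : coprime a'' b by apply: coprime_dvdl coab; rewrite e3 dvdn_mulr.
  have : a'' * b = g ^ 4 by move: eab; rewrite e3; lia.
  case/(coprime_pow4_factors co2) => g1 [g2 [e1 e2 eg co12]].
  have og2 : odd g2 by move: ob; rewrite e2 oddX.
  have g1p : 0 < g1 by move: g0; rewrite eg muln_gt0 => /andP[].
  have eP : p ^ 2 + 28 * (g1 ^ 2 * g2 ^ 2) = 192 * (g1 ^ 2) ^ 2 + (g2 ^ 2) ^ 2.
    by move: eX; rewrite e3 e1 e2 eg expnMn -!expnM; lia.
  have P0 : 0 < p ^ 2 by rewrite expn_gt0 p0.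
  case: (descent_factor P0 eP) => [[z ez e5]|[k ek e5]].
    have co5 : coprime z (z + 4 * g1 ^ 2).
      apply: (coprime_shift _ co12); last first.
        by move=> l lz lg; rewrite ez dvdn_add // dvdn_mull // dvdn_exp.
      by have := congr1 odd ez; rewrite oddX og2 oddD oddM addbF.
    have [u [y [eu ey _ _]]] := coprime_sqr_factors co5 e5.
    by exists g1; exists g2; exists u; exists y; split; rewrite -?eu -?ey ?ez.
  exfalso.
  have co5 : coprime k (k + 4 * g1 ^ 2).
    apply: (coprime_shift _ co12); last first.
      move=> l lk lg; rewrite -(dvdn_addr _ lk) -ek dvdn_mull //.
      by rewrite dvdn_exp.
    by have := congr1 odd ek; rewrite oddM oddD [odd (g2 ^ 2)]oddX og2 /= addbT; case: (odd k).
  have [u [y [eu _ _ _]]] := coprime_sqr_factors co5 e5.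
  have ou : odd u.
    by have := congr1 odd ek; rewrite eu oddM oddD ![odd (_ ^ 2)]oddX og2 /= addbT; case: (odd u).
  have [m em] := odd_sqr ou; have [n en] := odd_sqr og2.
  by lia.
exfalso; have co2 : coprime a' b'.
  by apply: coprime_dvdr coab; rewrite e3 dvdn_mulr.
have : a' * b' = g ^ 4 by move: eab; rewrite e3; lia.
case/(coprime_pow4_factors co2) => g1 [g2 [e1 e2 eg co12]].
have og2 : odd (g2 ^ 2).
  by move: ob; rewrite e3 e2 oddM !oddX => /andP[].
have [k ek] := odd_sqr op; have [l el] := odd_sqr og2.
have : p ^ 2 + 28 * (g1 * g2) ^ 2 = 64 * g1 ^ 4 + 3 * (g2 ^ 2) ^ 2.
  by move: eX; rewrite e3 e1 e2 eg -expnM; lia.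
by lia.
Qed.

(** Writing v^2 = (p^2 + 7 q^2)^2 - 48 q^4 with q = 2 g, the halves a and v + a of
    p^2 + 7 q^2 -+ v are coprime with product 192 g^4. The new solution comes with
    w = 2 g1, h = g2. *)
Lemma descent_pq p q v : 0 < p -> 0 < q -> odd p -> ~~ odd q -> coprime p q ->
  v ^ 2 = p ^ 4 + 14 * p ^ 2 * q ^ 2 + q ^ 4 ->
  exists w h u y, [/\ 0 < w, w * h <= q, u <= h,
     0 < u & u ^ 2 + w ^ 2 = y ^ 2 /\ u ^ 2 + 4 * w ^ 2 = h ^ 2].
Proof.
move=> p0 q0 op eq co ev.
have [g eg] : exists g, q = 2 * g by exists q./2; have := odd_double_half q; lia.
subst q; have g0 : 0 < g by lia.
have ov : odd v.
  by have := congr1 odd ev; rewrite !(oddX, oddD, oddM) op /=.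
have lev : v < p ^ 2 + 28 * g ^ 2.
  by rewrite -(ltn_exp2r _ _ (isT : 0 < 2)) ev; have : 0 < g ^ 4; [rewrite expn_gt0 g0|lia].
have [a ea] : exists a, p ^ 2 + 28 * g ^ 2 = v + 2 * a.
  exists (p ^ 2 + 28 * g ^ 2 - v)./2.
  have := odd_double_half (p ^ 2 + 28 * g ^ 2 - v).
  rewrite oddB 1?ltnW // oddD oddX op oddM ov /=; lia.
have eab : a * (v + a) = 192 * g ^ 4.
  have : (v + 2 * a) ^ 2 = v ^ 2 + 768 * g ^ 4 by rewrite -ea ev; lia.
  by lia.
have copg : coprime p g by apply: coprime_dvdr co; apply: dvdn_mull.
have coab : coprime a (v + a).
  apply: coprime_of_primes => l pl la lb.
  have lX : l %| p ^ 2 + 28 * g ^ 2.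
    by rewrite ea mul2n -addnn addnA dvdn_add.
  have lg : l %| g -> False.
    move=> lg; have : l %| p ^ 2.
      by move: lX; rewrite dvdn_addl // dvdn_mull // dvdn_exp.
    rewrite Euclid_dvdX // => /andP[lp _].
    by have := dvdn_gcd l p g; rewrite lg lp (eqP copg) dvdn1; case: eqP pl => // ->.
  have : l %| 192 * g ^ 4 by rewrite -eab dvdn_mulr.
  rewrite Euclid_dvdM // => /orP[]; last by rewrite Euclid_dvdX // => /andP[/lg].
  rewrite (_ : 192 = 2 ^ 6 * 3) // Euclid_dvdM // Euclid_dvdX // andbT !dvdn_prime2 //.
  case/orP=> /eqP el; move: lX; rewrite el.
    by rewrite dvdn2 oddD oddX op oddM.
  move=> h3; have n3p : ~~ (3 %| p).
    apply/negP => h; apply: lg; rewrite el.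
    have : 3 %| 28 * g ^ 2 by rewrite -(dvdn_addr _ (dvdn_exp (isT : 0 < 2) h)).
    by rewrite Euclid_dvdM // Euclid_dvdX // => /andP[].
  have n3g : ~~ (3 %| g) by apply/negP => h; apply: lg; rewrite el.
  have sq3 n : ~~ (3 %| n) -> exists k, n ^ 2 = 3 * k + 1.
    move=> n3; have := divn_eq n 3; have := ltn_pmod n (isT : 0 < 3).
    move: n3; rewrite /dvdn; set r := n %% 3; set d := n %/ 3 => r0 r3 ->.
    have [->|->] : r = 1 \/ r = 2 by lia.
      by exists (3 * d ^ 2 + 2 * d); lia.
    by exists (3 * d ^ 2 + 4 * d + 1); lia.
  have [k ek] := sq3 _ n3p; have [m em] := sq3 _ n3g.
  by case/dvdnP: h3 => n; lia.
have [g1 [g2 [u [y [e og2 e1 e2]]]]] : exists g1 g2 u y, [/\ g = g1 * g2, odd g2,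
     u ^ 2 + 16 * g1 ^ 2 = g2 ^ 2 & u ^ 2 + 4 * g1 ^ 2 = y ^ 2].
  have [oa|na] := boolP (odd a).
    apply: (@descent_step (v + a) a p g) => //; first by rewrite coprime_sym.
    - by rewrite oddD ov oa.
    - by rewrite ea; lia.
    - by rewrite mulnC.
  by apply: (@descent_step a (v + a) p g) => //; rewrite ea; lia.
have g20 : 0 < g2 by case: (g2) og2.
have g10 : 0 < g1 by move: g0; rewrite e muln_gt0 => /andP[].
have u0 : 0 < u.
  case: (posnP u) => // uz; move: e1; rewrite uz => e1.
  by have := congr1 odd e1; rewrite !oddX og2 oddD oddM.
exists (2 * g1); exists g2; exists u; exists y; split=> //; try lia.
by rewrite -leq_sqr -e1 leq_addr.
Qed.

(** Infinite descent on u x. For a primitive solution with u odd, u = p^2 - q^2 and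
    x = 2 p q with p, q coprime of opposite parity, and then
    v^2 = p^4 + 14 p^2 q^2 + q^4. *)
Theorem euler_concordant u x y v :
  u ^ 2 + x ^ 2 = y ^ 2 -> u ^ 2 + 4 * x ^ 2 = v ^ 2 -> u * x = 0.
Proof.
have [N] := ubnP (u * x); elim: N u x y v => // N IH u x y v leN e1 e2.
case: (posnP (u * x)) => // ux0.
have [u0 x0] : 0 < u /\ 0 < x by move: ux0; rewrite muln_gt0 => /andP.
exfalso.
have [co|nco] := boolP (coprime u x); last first.
  have [u' [x' [d [d1 eu ex]]]] : exists u' x' d, [/\ 1 < d, u = u' * d & x = x' * d].
    exists (u %/ gcdn u x), (x %/ gcdn u x), (gcdn u x).
    split; rewrite ?divnK ?dvdn_gcdl ?dvdn_gcdr //.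
    by move: nco; rewrite /coprime; have := gcdn_gt0 u x; rewrite u0 /=; lia.
  have dsq c m : u' ^ 2 * d ^ 2 + c * (x' ^ 2 * d ^ 2) = m ^ 2 ->
      exists k, u' ^ 2 + c * x' ^ 2 = k ^ 2.
    move=> e; have : d %| m.
      rewrite -(dvdn_pexp2r _ _ (isT : 0 < 2)) -e.
      by apply: dvdn_add; [apply: dvdn_mull | do 2 apply: dvdn_mull].
    case/dvdnP=> k em; exists k; apply/eqP.
    have d2 : 0 < d ^ 2 by rewrite expn_gt0 (ltnW d1).
    by rewrite -(eqn_pmul2r d2) mulnDl -mulnA e em expnMn.
  have [k ek] : exists k, u' ^ 2 + 1 * x' ^ 2 = k ^ 2.
    by apply: (dsq 1 y); rewrite -e1 eu ex !expnMn mul1n.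
  have [l el] : exists k, u' ^ 2 + 4 * x' ^ 2 = k ^ 2.
    by apply: (dsq 4 v); rewrite -e2 eu ex !expnMn.
  have eux : u * x = u' * x' * d ^ 2 by rewrite eu ex mulnACA.
  have s0 : 0 < u' * x' by move: ux0; rewrite eux muln_gt0 => /andP[].
  have ltN : u' * x' < N.
    rewrite ltnS in leN; apply: leq_trans leN; rewrite eux ltn_Pmulr //.
    by rewrite -(exp1n 2) ltn_exp2r.
  suff : u' * x' = 0 by lia.
  by apply: (IH _ _ k l) => //; rewrite -ek mul1n.
have [ou|eu] := boolP (odd u); last first.
  have [u' eu'] : exists u', u = 2 * u' by exists u./2; have := odd_double_half u; lia.
  have [v' ev'] : exists v', v = 2 * v'.
    exists v./2; have := odd_double_half v.
    by have := congr1 odd e2; rewrite oddD !oddX oddM (negPf eu) /= => <-; lia.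
  have : x * u' = 0 by apply: (IH _ _ v' y); subst; lia.
  by subst; lia.
have [k ek] := odd_sqr ou.
have ex : ~~ odd x.
  apply/negP => ox; have [l el] := odd_sqr ox.
  have [oy|ey] := boolP (odd y).
    by have := congr1 odd e1; rewrite oddD !oddX ou ox oy.
  have [y' ey'] : exists y', y = 2 * y' by exists y./2; have := odd_double_half y; lia.
  by subst y; lia.
have [x' ex'] : exists x', x = 2 * x' by exists x./2; have := odd_double_half x; lia.
have oy : odd y.
  by have := congr1 odd e1; rewrite oddD !oddX ou (negPf ex) /= => <-.
have ley : u <= y by rewrite -leq_sqr -e1 leq_addr.
have [a ea] : exists a, y = u + 2 * a.
  exists (y - u)./2; have := odd_double_half (y - u); rewrite oddB // oy ou /=; lia.
subst x y.
have eab : a * (u + a) = x' ^ 2 by lia.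
have coux : coprime u x' by apply: coprime_dvdr co; apply: dvdn_mull.
have coa : coprime a (u + a).
  apply: coprime_of_primes => l pl la; rewrite dvdn_addl // => lu.
  have : l %| x' ^ 2 by rewrite -eab dvdn_mulr.
  rewrite Euclid_dvdX // => /andP[lx _].
  by have := dvdn_gcd l u x'; rewrite lu lx (eqP coux) dvdn1; case: eqP pl => // ->.
have [q [p [eq ep exx copq]]] := coprime_sqr_factors coa eab.
have [q0 p0] : 0 < q /\ 0 < p.
  by apply/andP; rewrite -muln_gt0 -exx; lia.
have ev : v ^ 2 = p ^ 4 + 14 * p ^ 2 * q ^ 2 + q ^ 4.
  rewrite -e2; have eup : p ^ 2 = u + q ^ 2 by rewrite -ep eq.
  rewrite exx (expnM p 2 2) (expnM q 2 2) !expnMn eup; lia.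
have [w [h [u2 [y2 [w0 lew leu2 u20 [f1 f2]]]]]] : exists w h u2 y2,
   [/\ 0 < w, w * h <= p * q, u2 <= h, 0 < u2 &
       u2 ^ 2 + w ^ 2 = y2 ^ 2 /\ u2 ^ 2 + 4 * w ^ 2 = h ^ 2].
  have opq : odd p = ~~ odd q.
    by have := congr1 odd ep; rewrite oddD eq !oddX ou /= => <-.
  have [oq|nq] := boolP (odd q).
    have [||||||w [h [u2 [y2 [? ? ? ? ?]]]]] := @descent_pq q p v => //.
    - by rewrite opq oq.
    - by rewrite ev; lia.
    by exists w, h, u2, y2; split=> //; apply: leq_trans (leq_pmulr p q0).
  have [||||||w [h [u2 [y2 [? ? ? ? ?]]]]] := @descent_pq p q v => //.
  - by rewrite opq nq.
  - by rewrite coprime_sym.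
  by exists w, h, u2, y2; split=> //; apply: leq_trans (leq_pmull q p0).
have : u2 * w = 0.
  apply: (IH _ _ y2 h) => //; rewrite ltnS in leN; apply: leq_trans leN.
  have h1 : u2 * w <= h * w by rewrite leq_mul2r leu2 orbT.
  have h2 : p * q < u * (2 * x') by rewrite exx; have := leq_pmull (2 * (q * p)) u0; lia.
  lia.
lia.
Qed.

End EulerDescent.

(** * The p-adic valuation on the rationals *)

Section Padic.
Variable p : nat.
Hypothesis p_pr : prime p.
Implicit Types x y : rat.

(** The local ring of p-integral rationals, and (below) its maximal ideal. *)
Definition pint x := ~~ (p %| `|denq x|)%N.
Definition pmax x := pint (x / p%:R).

Let p_neq0 : (p%:R : rat) != 0.
Proof. by rewrite pnatr_eq0 -lt0n prime_gt0. Qed.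

Lemma absz_dvd_neq0 (b : int) : ~~ (p %| `|b|)%N -> b != 0.
Proof. by apply: contraNneq => ->. Qed.

Lemma num_den x : x = (numq x)%:~R / (denq x)%:~R.
Proof. by rewrite divq_num_den. Qed.

Lemma frac_cross x (a b : int) : b != 0 -> x = a%:~R / b%:~R ->
  numq x * b = a * denq x.
Proof.
move=> b0 e; apply: (@intr_inj rat); rewrite !rmorphM /=.
have d0 : ((denq x)%:~R : rat) != 0 by rewrite intr_eq0 denq_neq0.
have b0' : (b%:~R : rat) != 0 by rewrite intr_eq0.
have := e; rewrite {1}(num_den x) => e'.
by rewrite -[(numq x)%:~R](divfK d0) e' mulrAC divfK.
Qed.

Lemma pint_frac (a b : int) : ~~ (p %| `|b|)%N -> pint (a%:~R / b%:~R).
Proof.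
move=> nb; have b0 := absz_dvd_neq0 nb.
have e := frac_cross b0 (erefl (a%:~R / b%:~R : rat)).
apply: contra nb => pd; set x : rat := _ / _ in e pd *.
have : (p %| `|numq x| * `|b|)%N by rewrite -abszM e abszM dvdn_mull.
rewrite Euclid_dvdM // => /orP[pn|//].
have := coprime_num_den x; rewrite /coprime => /eqP g.
by have := dvdn_gcd p `|numq x| `|denq x|; rewrite pn pd g dvdn1; case: eqP p_pr => // ->.
Qed.

Lemma pint_int (n : int) : pint n%:~R.
Proof. by rewrite /pint denq_int absz1 dvdn1; case: eqP p_pr => // ->. Qed.

Lemma pint_nat (n : nat) : pint n%:R.
Proof. by rewrite -[n%:R]/(n%:~R) pint_int. Qed.

Lemma pint0 : pint 0. Proof. exact: (pint_nat 0). Qed.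
Lemma pint1 : pint 1. Proof. exact: (pint_nat 1). Qed.

Let den0 x : ((denq x)%:~R : rat) != 0.
Proof. by rewrite intr_eq0 denq_neq0. Qed.

Lemma pintD x y : pint x -> pint y -> pint (x + y).
Proof.
move=> hx hy; rewrite (num_den x) (num_den y) addf_div ?den0 // -!intrM -intrD.
by apply: pint_frac; rewrite abszM Euclid_dvdM // negb_or; apply/andP.
Qed.

Lemma pintM x y : pint x -> pint y -> pint (x * y).
Proof.
move=> hx hy; rewrite (num_den x) (num_den y) mulf_div -!intrM.
by apply: pint_frac; rewrite abszM Euclid_dvdM // negb_or; apply/andP.
Qed.

Lemma pintN x : pint x -> pint (- x).
Proof. by rewrite /pint denqN. Qed.

Lemma pintX x n : pint x -> pint (x ^+ n).
Proof. by move=> hx; elim: n => [|n IH]; rewrite ?expr0 ?pint1 // exprS pintM. Qed.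

Lemma pint_natV n : ~~ (p %| n)%N -> pint (n%:R^-1).
Proof.
by move=> h; rewrite -[_^-1]mul1r -[1]/(1%:~R) -[n%:R]/(n%:~R) pint_frac.
Qed.

Lemma pmaxD x y : pmax x -> pmax y -> pmax (x + y).
Proof. by rewrite /pmax mulrDl; apply: pintD. Qed.

Lemma pmaxN x : pmax x -> pmax (- x).
Proof. by rewrite /pmax mulNr; apply: pintN. Qed.

Lemma pmaxB x y : pmax x -> pmax y -> pmax (x - y).
Proof. by move=> hx hy; apply: pmaxD => //; apply: pmaxN. Qed.

Lemma pmaxM x y : pint x -> pmax y -> pmax (x * y).
Proof. by rewrite /pmax -mulrA; apply: pintM. Qed.

Lemma pmaxMr x y : pmax x -> pint y -> pmax (x * y).
Proof. by move=> hx hy; rewrite mulrC pmaxM. Qed.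

Lemma pmax_pint x : pmax x -> pint x.
Proof. by move=> h; rewrite -[x](divfK p_neq0) pintM ?pint_nat. Qed.

Lemma pmax1 : ~~ pmax 1.
Proof.
rewrite /pmax mul1r /pint -[p%:R]/(p%:~R) denqVz ?absz_id ?negbK //=.
by rewrite -lt0n prime_gt0.
Qed.

(** Numerator and denominator are coprime: this makes pint a valuation ring, the only
    property used to see that it is integrally closed and that 1 + a is a unit for
    a in the maximal ideal. *)
Lemma pmax_inv x : ~~ pint x -> pmax x^-1.
Proof.
rewrite negbK => /dvdnP[k e].
have dz : denq x = k%:Z * p%:Z by rewrite -[denq x]gez0_abs ?denq_ge0 // e PoszM.
have ek : x^-1 / p%:R = k%:~R / (numq x)%:~R.
  rewrite {1}(num_den x) invf_div dz intrM -[p%:~R]/(p%:R).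
  by rewrite mulrAC mulfK.
rewrite /pmax ek pint_frac //; apply/negP => pn.
have := coprime_num_den x; rewrite /coprime => /eqP g.
have pd : (p %| `|denq x|)%N by rewrite e dvdn_mull.
by have := dvdn_gcd p `|numq x| `|denq x|; rewrite pn pd g dvdn1; case: eqP p_pr => // ->.
Qed.

Lemma pint_root x n : pint (x ^+ n.+1) -> pint x.
Proof.
move=> h; apply: contraT => nx; have hv := pmax_inv nx.
have x0 : x != 0 by apply: contraNneq nx => ->; rewrite pint0.
have hvX : pmax (x^-1 ^+ n.+1).
  by rewrite exprS pmaxMr // pintX // pmax_pint.
by have := pmaxM h hvX; rewrite -exprMn mulfV // expr1n (negPf pmax1).
Qed.

Lemma pmax_1addV a : pmax a -> 1 + a != 0 /\ pint (1 + a)^-1.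
Proof.
move=> ha; have n0 : 1 + a != 0.
  apply: contraNneq pmax1 => e; have -> : 1 = - a by apply/eqP; rewrite -subr_eq0 opprK e.
  exact: pmaxN.
split=> //; apply: contraT => /pmax_inv; rewrite invrK => h.
by have := pmaxB h ha; rewrite addrK (negPf pmax1).
Qed.

(** Parity of the p-adic valuation: numerator and denominator contribute alike. *)
Definition oddv x := odd (logn p (`|numq x| * `|denq x|)).

Lemma oddv_frac (a b : int) : a != 0 -> b != 0 ->
  oddv (a%:~R / b%:~R) = odd (logn p (`|a| * `|b|)).
Proof.
move=> a0 b0; set x : rat := _ / _.
have x0 : numq x != 0.
  by rewrite numq_eq0 mulf_neq0 ?invr_eq0 ?intr_eq0.
have := congr1 (fun z : int => logn p `|z|) (frac_cross b0 (erefl x)).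
rewrite /oddv /= !abszM !lognM ?absz_gt0 ?denq_neq0 // !oddD => e.
have := congr1 odd e; rewrite !oddD.
by do 4 case: (odd _).
Qed.

Lemma oddvM x y : x != 0 -> y != 0 -> oddv (x * y) = oddv x (+) oddv y.
Proof.
move=> x0 y0; rewrite [in LHS](num_den x) [in LHS](num_den y) mulf_div -!intrM.
rewrite oddv_frac ?mulf_neq0 ?numq_eq0 ?denq_neq0 // /oddv !abszM.
by rewrite mulnACA lognM ?oddD // !muln_gt0 !absz_gt0 ?numq_eq0 ?denq_neq0 ?x0 ?y0.
Qed.

Lemma oddv_sqr x : oddv (x ^+ 2) = false.
Proof.
have [->|x0] := eqVneq x 0; last by rewrite expr2 oddvM // addbb.
by rewrite expr0n /= /oddv (numq_int 0) mul0n logn0.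
Qed.

Lemma oddv_unit x : x != 0 -> pint x -> pint x^-1 -> oddv x = false.
Proof.
move=> x0 hx hv.
suff nx : ~~ (p %| `|numq x|)%N.
  by rewrite /oddv lognE p_pr Euclid_dvdM // (negPf nx) (negPf hx) andbF.
have e : numq x * numq x^-1 = denq x * denq x^-1.
  apply: (@intr_inj rat); rewrite !rmorphM /= !numqE.
  by rewrite mulrACA mulfV // mul1r.
apply/negP => pn; have : (p %| `|denq x| * `|denq x^-1|)%N.
  by rewrite -abszM -e abszM dvdn_mulr.
by rewrite Euclid_dvdM // (negPf hx) (negPf hv).
Qed.

Lemma oddv_1add a : pmax a -> oddv (1 + a) = false.
Proof.
move=> ha; have [n0 hv] := pmax_1addV ha.
by apply: oddv_unit => //; apply: pintD (pint1) (pmax_pint ha).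
Qed.

End Padic.

Lemma not_sqr_oddv (x : rat) : 0 < x -> (forall z : rat, x <> z ^+ 2) ->
  exists2 p, prime p & oddv p x.
Proof.
move=> x0 nsq; pose N := (`|numq x| * `|denq x|)%N.
have [/hasP[p]|/hasPn nodd] := boolP (has (fun p => oddv p x) (primes N)).
  by rewrite mem_primes => /andP[pp _] op; exists p.
have [p pp|r er] := @even_logn_sqr N.
  apply/negP => op; have lp : (0 < logn p N)%N by case: (logn p N) op.
  by have := nodd p; rewrite -logn_gt0 lp /oddv -/N op => /(_ isT).
case: (nsq (r%:R / (denq x)%:~R)).
have d0 : ((denq x)%:~R : rat) != 0 by rewrite intr_eq0 denq_neq0.
have eN : (N%:R : rat) = (numq x)%:~R * (denq x)%:~R.
  by rewrite natrM !natr_absz normr_denq ger0_norm // numq_ge0 ltW.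
by rewrite expr_div_n -natrX -er eN expr2 invfM mulrA mulfK // -num_den.
Qed.

Lemma oddv2_small : [/\ oddv 2 2, oddv 2 3 = false, oddv 2 6 & oddv 2 9 = false].
Proof. by []. Qed.

Lemma oddv_leq p (x : rat) : oddv p x -> (p <= `|numq x| * `|denq x|)%N.
Proof.
rewrite /oddv; set h := (_ * _)%N => od.
have : (0 < logn p h)%N by case: (logn p h) od.
by rewrite logn_gt0 mem_primes => /and3P[_ h0 ph]; exact: dvdn_leq.
Qed.

(* Unfolding the valuation of a numeral would make conversion factor integers. *)
#[global] Opaque oddv.

(** * Three independent points on a congruent number curve *)

Section CongruentCurve.
Variable n : rat.
Hypothesis n0 : n != 0.

Lemma cubic_congruent x : cubic (congruent_curve n) x = x * (x - n) * (x + n).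
Proof. by rewrite /cubic /=; ring. Qed.

Lemma dcubic_congruent x : dcubic (congruent_curve n) x = 3 * x ^+ 2 - n ^+ 2.
Proof. by rewrite /dcubic /=; ring. Qed.

Lemma congruent_roots x : cubic (congruent_curve n) x = 0 ->
  [\/ x = 0, x = n | x = - n].
Proof.
rewrite cubic_congruent => /eqP; rewrite !mulf_eq0 subr_eq0 addr_eq0.
by case/orP=> [/orP[]|] /eqP; [constructor 1|constructor 2|constructor 3].
Qed.

Lemma congruent_nonsingular : nonsingular (congruent_curve n).
Proof.
split=> // x /congruent_roots; rewrite dcubic_congruent.
have n20 : 2 * n ^+ 2 != 0 by rewrite mulf_neq0 // expf_neq0.
case=> ->; first by rewrite expr0n mulr0 sub0r oppr_eq0 expf_neq0.
- by rewrite (_ : _ - _ = 2 * n ^+ 2) //; ring.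
- by rewrite (_ : _ - _ = 2 * n ^+ 2) //; ring.
Qed.

Definition congruent_ec := ECurve congruent_nonsingular.

Lemma two_torsion (T : ecpoint congruent_ec) : T *+ 2 = 0 ->
  pt T = Infty \/ exists x, pt T = Aff x 0 /\ [\/ x = 0, x = n | x = - n].
Proof.
rewrite mulr2n => /eqP; rewrite addr_eq0 => /eqP/(congr1 (@pt _ _)); rewrite ptN.
case: T => [[|x y] /= h]; first by left.
case=> ey; right; exists x.
have y0 : y = 0.
  by lra.
subst y; split=> //; apply: congruent_roots.
by move/eqP: h; rewrite /cubic /= => <-; rewrite expr0n.
Qed.

End CongruentCurve.

Lemma chi_sum4 (F : fieldType) (E : ecurve F) (e : F) (P1 P2 P3 T S : ecpoint E)
    (r1 r2 r3 : bool) :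
  cubic E e = 0 -> P1 *+ r1 + P2 *+ r2 + P3 *+ r3 + T = S *+ 2 ->
  nzsqr ((if r1 then chi E e P1 else 1) * (if r2 then chi E e P2 else 1) *
       (if r3 then chi E e P3 else 1) * chi E e T).
Proof.
move=> e0 eS.
have cb (P : ecpoint E) (r : bool) : (if r then chi E e P else 1) = chi E e (P *+ r)%R.
  by case: r.
rewrite !{}cb.
move: (P1 *+ r1) (P2 *+ r2) (P3 *+ r3) eS => Q1 Q2 Q3 eS.
have h0 := chi_double e0 S; rewrite -mulr2n -eS in h0.
have h1 := chiD e0 (Q1 + Q2 + Q3) T.
have h2 := chiD e0 (Q1 + Q2) Q3.
have h3 := chiD e0 Q1 Q2.
move: h0 h1 h2 h3 (chi_neq0 e0 (Q1 + Q2 + Q3 + T)) (chi_neq0 e0 (Q1 + Q2 + Q3))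
  (chi_neq0 e0 (Q1 + Q2)).
move: (chi E e (Q1 + Q2 + Q3 + T)) (chi E e (Q1 + Q2 + Q3)) (chi E e (Q1 + Q2)).
move=> a b c h0 h1 h2 h3 a0 b0 c0.
apply: (@nzsqr_cancel _ _ (a * b * c)); last by rewrite !mulf_neq0.
have := nzsqrM (nzsqrM (nzsqrM h0 h1) h2) h3.
by congr nzsqr; ring.
Qed.

Lemma nzsqr_gt0 (q : rat) : nzsqr q -> 0 < q.
Proof. by case=> z z0 ->; rewrite exprn_even_gt0. Qed.

Lemma nzsqr_oddv p (q : rat) : nzsqr q -> oddv p q = false.
Proof. by case=> z z0 ->; rewrite oddv_sqr. Qed.

Lemma oddvM3 p (x y z : rat) : x != 0 -> y != 0 -> z != 0 ->
  oddv p (x * y * z) = oddv p x (+) oddv p y (+) oddv p z.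
Proof. by move=> x0 y0 z0; rewrite (oddvM p (mulf_neq0 x0 y0) z0) oddvM. Qed.

Lemma rat2369_neq0 :
  [/\ 2 != 0 :> rat, 3 != 0 :> rat, 6 != 0 :> rat & 9 != 0 :> rat].
Proof. by []. Qed.

(** A has odd 2-adic valuation, B and C even; hence n is odd in this sense, and so is
    the third point under the character at n, while the other values are even. The
    first part rules out the torsion point (n, 0) in a relation modulo doubles, the
    second one the third point. *)
Lemma class_parities (A B C t a : rat) : a != 0 -> A = 2 * a ^+ 2 ->
  A != 0 -> B != 0 -> C != 0 -> t != 0 ->
  oddv 2 B = false -> oddv 2 C = false ->
  (forall r1 r2 r3 : bool, 
     nzsqr ((if r1 then 3 * B ^+ 2 * C else 1) * (if r2 then 3 * B * C ^+ 2 else 1)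
          * (if r3 then 6 * A * C ^+ 2 else 1) * (3 * A * B * C)) -> False) /\
  (forall r1 r2 r3 : bool,
     nzsqr ((if r1 then 9 * B * C else 1) * (if r2 then 3 * B ^+ 2 * C else 1)
          * (if r3 then 9 * t ^+ 2 * A * C else 1)) -> r3 = false).
Proof.
move=> a0 eA An Bn Cn tn vB vC.
have vX := @oddv_sqr 2%N; have [v2 v3 v6 v9] := oddv2_small.
have [k2 k3 k6 k9] := rat2369_neq0.
have a2 : a ^+ 2 != 0 := expf_neq0 2 a0.
have B2 : B ^+ 2 != 0 := expf_neq0 2 Bn.
have C2 : C ^+ 2 != 0 := expf_neq0 2 Cn.
have t2 : t ^+ 2 != 0 := expf_neq0 2 tn.
have n9 := mulf_neq0 k9 t2; have n3 := mulf_neq0 k3 An.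
have vA : oddv 2 A by rewrite eA (oddvM 2%N k2 a2) vX v2.
have if0 (r : bool) (q : rat) : q != 0 -> (if r then q else 1) != 0 by case: r.
have vif (r : bool) (q : rat) : oddv 2 (if r then q else 1) = r && oddv 2 q.
  by case: r.
have v10 : oddv 2 (3 * B ^+ 2 * C) = false by rewrite (oddvM3 2%N k3 B2 Cn) vX vC v3.
have v20 : oddv 2 (3 * B * C ^+ 2) = false by rewrite (oddvM3 2%N k3 Bn C2) vX vB v3.
have v30 : oddv 2 (6 * A * C ^+ 2) = false by rewrite (oddvM3 2%N k6 An C2) vX vA v6.
have v1n : oddv 2 (9 * B * C) = false by rewrite (oddvM3 2%N k9 Bn Cn) vB vC v9.
have v3n : oddv 2 (9 * t ^+ 2 * A * C).
  by rewrite (oddvM3 2%N n9 An Cn) (oddvM 2%N k9 t2) vX vA vC v9.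
have vn : oddv 2 (3 * A * B * C).
  by rewrite (oddvM3 2%N n3 Bn Cn) (oddvM 2%N k3 An) vA vB vC v3.
have m10 := mulf_neq0 (mulf_neq0 k3 B2) Cn.
have m20 := mulf_neq0 (mulf_neq0 k3 Bn) C2.
have m30 := mulf_neq0 (mulf_neq0 k6 An) C2.
have m1n := mulf_neq0 (mulf_neq0 k9 Bn) Cn.
have m3n := mulf_neq0 (mulf_neq0 n9 An) Cn.
have mn := mulf_neq0 (mulf_neq0 n3 Bn) Cn.
split=> r1 r2 r3 /(@nzsqr_oddv 2%N).
  rewrite (oddvM 2%N (mulf_neq0 (mulf_neq0 (if0 r1 _ m10) (if0 r2 _ m20))
                                (if0 r3 _ m30)) mn).
  rewrite (oddvM3 2%N (if0 r1 _ m10) (if0 r2 _ m20) (if0 r3 _ m30)) !vif.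
  by rewrite v10 v20 v30 vn !andbF.
rewrite (oddvM3 2%N (if0 r1 _ m1n) (if0 r2 _ m10) (if0 r3 _ m3n)) !vif.
by rewrite v1n v10 v3n !andbF andbT.
Qed.

Section ThreePoints.
Variables t a w : rat.
Let A : rat := t ^+ 2 - 1.
Let B : rat := t ^+ 2 + 2.
Let C : rat := 2 * t ^+ 2 + 1.
Hypotheses (a0 : a != 0) (eA : A = 2 * a ^+ 2).
Hypothesis ew : w ^+ 2 = 2 * A * (5 * t ^+ 2 + 4).
Hypotheses (vB : oddv 2 B = false) (vC : oddv 2 C = false).
Hypothesis nsq : forall z : rat, B * C <> z ^+ 2.

Let t20 : 0 <= t ^+ 2. Proof. exact: sqr_ge0. Qed.
Let A0 : 0 < A. Proof. by rewrite eA pmulr_rgt0 // exprn_even_gt0. Qed.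
Let B0 : 0 < B. Proof. by rewrite /B ltr_wpDl. Qed.
Let C0 : 0 < C. Proof. by rewrite /C ltr_wpDl // mulr_ge0. Qed.
Let t0 : t != 0.
Proof. by apply: contraTneq A0 => t0; rewrite /A t0 expr0n. Qed.

Let n : rat := n_of t.
Let nE : n = 3 * A * B * C. Proof. by rewrite /n /n_of /A /B /C; ring. Qed.
Let n0 : 0 < n. Proof. by rewrite nE !pmulr_rgt0. Qed.
Let nn0 : n != 0. Proof. by rewrite gt_eqF. Qed.

Lemma curve_pt1 : on_curve (congruent_curve n) (Aff (3 * B ^+ 2 * C) (9 * B ^+ 2 * C ^+ 2)).
Proof. by rewrite on_curveE cubic_congruent nE; apply/eqP; rewrite /A /B /C; ring. Qed.
Lemma curve_pt2 : on_curve (congruent_curve n) (Aff (3 * B * C ^+ 2) (9 * t * B ^+ 2 * C ^+ 2)).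
Proof. by rewrite on_curveE cubic_congruent nE; apply/eqP; rewrite /A /B /C; ring. Qed.
Lemma curve_pt3 : on_curve (congruent_curve n) (Aff (6 * A * C ^+ 2) (9 * t * A * C ^+ 2 * w)).
Proof.
rewrite on_curveE cubic_congruent nE exprMn ew; apply/eqP.
by rewrite /A /B /C; ring.
Qed.

(** The classes of the points under the characters at 0 and n are (3 C, B C),
    (3 B, 3 C) and (6 A, A C) modulo squares. The torsion points (0, 0) and (-n, 0) are
    excluded by the sign at 0, then (n, 0) and the third point by the parity of the
    2-adic valuation. Each nontrivial combination of the first two points being
    a double would make B C a square. *)
Lemma three_independent_points : has_three_indep_points (congruent_curve n).
Proof.
pose E := congruent_ec nn0.
pose P1 : ecpoint E := @ECPoint _ E _ curve_pt1.
pose P2 : ecpoint E := @ECPoint _ E _ curve_pt2.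
pose P3 : ecpoint E := @ECPoint _ E _ curve_pt3.
exists (pt P1), (pt P2), (pt P3).
split; [exact: curve_pt1|exact: curve_pt2|exact: curve_pt3|].
move=> m1 m2 m3; rewrite -[congruent_curve n]/(ecurve_val E).
rewrite -!(pt_mulz (E := E)) -!(ptD (E := E)) => e.
apply: (@independent_of_mod2 _ P1 P2 P3) => [|]; last exact: val_inj.
move=> r1 r2 r3 T S T2 eS {e m1 m2 m3}.
have c0 : cubic E 0 = 0 by rewrite cubic_congruent !mul0r.
have cn : cubic E n = 0 by rewrite cubic_congruent subrr mulr0 mul0r.
have := chi_sum4 c0 eS; have := chi_sum4 cn eS.
have x10 : 3 * B ^+ 2 * C - n = 9 * B * C by rewrite nE /A /B /C; ring.
have x20 : 3 * B * C ^+ 2 - n = 3 * B ^+ 2 * C by rewrite nE /A /B /C; ring.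
have x30 : 6 * A * C ^+ 2 - n = 9 * t ^+ 2 * A * C by rewrite nE /A /B /C; ring.
have Bn : B != 0 by rewrite gt_eqF. have Cn : C != 0 by rewrite gt_eqF.
have An : A != 0 by rewrite gt_eqF.
have n1 : 9 * B * C != 0 by rewrite !mulf_neq0.
have n2 : 3 * B ^+ 2 * C != 0 by rewrite !mulf_neq0 ?expf_neq0.
have n3 : 9 * t ^+ 2 * A * C != 0 by rewrite !mulf_neq0 ?expf_neq0.
have chi_aff e x y : x - e != 0 -> chi E e (Aff x y) = x - e.
  by rewrite subr_eq0 /chi => /negbTE ->.
have chi1n : chi E n (pt P1) = 9 * B * C by rewrite -x10; apply: chi_aff; rewrite x10.
have chi2n : chi E n (pt P2) = 3 * B ^+ 2 * C by rewrite -x20; apply: chi_aff; rewrite x20.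
have chi3n : chi E n (pt P3) = 9 * t ^+ 2 * A * C by rewrite -x30; apply: chi_aff; rewrite x30.
have n4 : 3 * B * C ^+ 2 != 0 by rewrite !mulf_neq0 ?expf_neq0.
have n5 : 6 * A * C ^+ 2 != 0 by rewrite !mulf_neq0 ?expf_neq0.
have chi10 : chi E 0 (pt P1) = 3 * B ^+ 2 * C.
  by rewrite -[RHS]subr0; apply: chi_aff; rewrite subr0.
have chi20 : chi E 0 (pt P2) = 3 * B * C ^+ 2.
  by rewrite -[RHS]subr0; apply: chi_aff; rewrite subr0.
have chi30 : chi E 0 (pt P3) = 6 * A * C ^+ 2.
  by rewrite -[RHS]subr0; apply: chi_aff; rewrite subr0.
rewrite chi1n chi2n chi3n chi10 chi20 chi30 => hn h0.
have [en eI] := class_parities a0 eA An Bn Cn t0 vB vC.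
have [eT|[x [eT ex]]] := two_torsion T2; last first.
  exfalso; have gtif (r : bool) (q : rat) : 0 < q -> 0 < (if r then q else 1).
    by case: r.
  have : 0 < chi E 0 (pt T).
    have := nzsqr_gt0 h0; rewrite pmulr_rgt0 //.
    by rewrite !mulr_gt0 ?gtif ?mulr_gt0 ?exprn_gt0.
  rewrite eT /chi; case: eqVneq => [_|x0].
    by rewrite dcubic_congruent expr0n mulr0 sub0r oppr_gt0 ltNge sqr_ge0.
  case: ex x0 eT => [->|->|->] x0 eT; first by rewrite eqxx in x0.
    rewrite subr0 => _; move: h0.
    by rewrite eT /chi (negPf x0) subr0 nE => /en.
  by rewrite subr0 oppr_gt0 ltNge ltW.
rewrite eT /chi !mulr1 in h0 hn.
have T0 : T = 0 by apply: val_inj; rewrite /= eT.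
have r30 : r3 = false by apply: eI hn.
rewrite r30 !mulr1 in h0 hn.
have BCn : B * C != 0 by rewrite mulf_neq0.
have nBC : ~ nzsqr (B * C) by case=> z _ /nsq.
case: r1 h0 hn {eS} => h0 hn.
  exfalso; case: r2 h0 hn => h0 hn; apply: nBC.
    apply: (@nzsqr_cancel _ _ (3 * B * C)); last by rewrite !mulf_neq0.
    by move: h0; congr nzsqr; ring.
  apply: (@nzsqr_cancel _ _ 3) => //.
  by move: hn; congr nzsqr; ring.
case: r2 h0 hn => h0 hn; last by [].
exfalso; apply: nBC.
apply: (@nzsqr_cancel _ _ (3 * B * C)); last by rewrite !mulf_neq0.
by move: (nzsqrM h0 hn); congr nzsqr; ring.
Qed.
End ThreePoints.

(** * The kernel of reduction modulo p *)

Ltac pint_tac := repeat lazymatch goal with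
  | H : is_true (prime ?p) |- is_true (pint ?p (_ + _)) => apply: (pintD H)
  | H : is_true (prime ?p) |- is_true (pint ?p (_ * _)) => apply: (pintM H)
  | H : is_true (prime ?p) |- is_true (pint ?p (_ ^+ _)) => apply: (pintX H)
  | |- is_true (pint _ (- _)) => apply: pintN
  | H : is_true (prime ?p) |- is_true (pint ?p 1) => apply: (pint1 H)
  | H : is_true (prime ?p) |- is_true (pint ?p (_%:R)) => apply: (pint_nat H)
  | |- _ => assumption
  end.

Section Reduction.
Variables (E : ecurve rat) (p : nat).
Hypothesis p_pr : prime p.
Hypotheses (i2 : pint p (a2 E)) (i4 : pint p (a4 E)) (i6 : pint p (a6 E)).

(** The points which reduce to the origin modulo p. Stated on
    abscissas, so that no curve modulo p has to be formed. *)
Definition in_ker (P : point rat) : bool :=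
  if P is Aff x _ then ~~ pint p x else true.

Lemma pint_cubic x : pint p x -> pint p (cubic E x).
Proof. by move=> hx; rewrite /cubic; pint_tac. Qed.

Lemma pint_ordinate x y : y ^+ 2 = cubic E x -> pint p x -> pint p y.
Proof. by move=> e hx; apply: (@pint_root _ p_pr _ 1); rewrite e pint_cubic. Qed.

(** With w = 1 / x1 in the maximal ideal, the abscissa of the sum is an expression in
    w, x2, y2 and v = y1 w^2 over the unit (1 - w x2)^2; and v is integral since
    v^2 = w + a2 w^2 + a4 w^3 + a6 w^4. *)
Lemma addp_ker_notin_ker (P R : point rat) : on_curve E P -> on_curve E R ->
  in_ker P -> P != Infty -> ~~ in_ker R -> ~~ in_ker (addp E P R).
Proof.
case: P => [|x1 y1]; first by rewrite eqxx.
case: R => [|x2 y2] // /eqP h1 /eqP h2.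
rewrite [in_ker (Aff x1 y1)]/in_ker [in_ker (Aff x2 y2)]/in_ker negbK => k1 _ k2.
have n12 : x1 != x2 by apply: contraNneq k1 => ->.
have n21 : x2 - x1 != 0 by rewrite subr_eq0 eq_sym.
have ne : ~~ ((x1 == x2) && (y1 == - y2)) by rewrite (negPf n12).
rewrite (addp_aff _ ne) /in_ker negbK /slope (negPf n12).
have x10 : x1 != 0 by apply: contraNneq k1 => ->; apply: pint0.
pose w := x1^-1; have mw : pmax p w by apply: pmax_inv.
have iw : pint p w by apply: pmax_pint.
have ex1 : x1 = w^-1 by rewrite /w invrK.
have w0 : w != 0 by rewrite invr_eq0.
have [d0 iD] : 1 + - (w * x2) != 0 /\ pint p (1 + - (w * x2))^-1.
  by apply: pmax_1addV => //; apply: pmaxN => //; apply: pmaxMr.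
have iv : pint p (y1 * w ^+ 2).
  apply: (@pint_root _ p_pr _ 1).
  have -> : (y1 * w ^+ 2) ^+ 2 = w + a2 E * w ^+ 2 + a4 E * w ^+ 3 + a6 E * w ^+ 4.
    by rewrite exprMn h1 ex1; field.
  by pint_tac.
have iy2 := pint_ordinate h2 k2.
have -> : ((y2 - y1) / (x2 - x1)) ^+ 2 - a2 E - x1 - x2 =
  (x2 * (1 + w * x2) + a4 E * w * (1 + w * x2) + 2 * a2 E * w * x2
   + 2 * a6 E * w ^+ 2 - 2 * (y1 * w ^+ 2) * y2) * ((1 + - (w * x2))^-1) ^+ 2.
  have -> : ((y2 - y1) / (x2 - x1)) ^+ 2 =
            (cubic E x1 + cubic E x2 - 2 * y1 * y2) / (x2 - x1) ^+ 2.
    by rewrite /cubic -h1 -h2; field.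
  move: n21; rewrite /cubic ex1 => n21; field.
  by rewrite d0 w0 [x2 * w]mulrC -oppr_eq0 opprB.
by move: (y1 * w ^+ 2) iv => v iv; pint_tac.
Qed.

(** Otherwise Q, the sum of - P in the kernel and P + Q outside, would be outside. *)
Lemma in_kerD (P Q : ecpoint E) : in_ker P -> in_ker Q -> in_ker (P + Q).
Proof.
move=> kP kQ; apply: contraLR kQ => kS.
have [eP|nP] := eqVneq (pt P) Infty.
  by move: kS; rewrite ptD eP add0p.
have -> : Q = - P + (P + Q) by rewrite addrA addNr add0r.
rewrite ptD; apply: addp_ker_notin_ker => //; try exact: ptP.
  by rewrite ptN; case: (pt P) kP.
by rewrite ptN; case: (pt P) nP.
Qed.

Lemma in_kerMn (P : ecpoint E) m : in_ker P -> in_ker (P *+ m).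
Proof. by move=> kP; elim: m => // m IH; rewrite mulrS in_kerD. Qed.

Hypothesis p_odd : p != 2.
Hypothesis good : forall x, pint p x -> pmax p (cubic E x) -> ~~ pmax p (dcubic E x).

Let i2V : pint p (2^-1).
Proof.
apply: (@pint_natV _ p_pr 2); rewrite dvdn_prime2 //.
Qed.

(** If the slope l of the line through P and - P' were integral, then y1 and the
    derivative of the cubic at x1 would be in the maximal ideal, that is, P would reduce
    to a singular point: the curve equation gives l (y1 - y2) as the difference
    quotient of the cubic. *)
Lemma congruent_sub_in_ker x1 y1 x2 y2 : y1 ^+ 2 = cubic E x1 -> y2 ^+ 2 = cubic E x2 ->
  pint p x1 -> pint p x2 -> pmax p (x1 - x2) -> pmax p (y1 - y2) ->
  in_ker (addp E (Aff x1 y1) (Aff x2 (- y2))).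
Proof.
move=> h1 h2 k1 k2 mx my.
have [eq|ne] := boolP ((x1 == x2) && (y1 == - - y2)); first by rewrite /addp eq.
have h2' : (- y2) ^+ 2 = cubic E x2 by rewrite sqrrN.
rewrite (addp_aff _ ne) /in_ker; apply/negP => ix3.
have iy1 := pint_ordinate h1 k1; have iy2 := pint_ordinate h2 k2.
set l := slope E x1 y1 x2 (- y2) in ix3.
have il : pint p l.
  apply: (@pint_root _ p_pr _ 1).
  rewrite (_ : l ^+ 2 = (l ^+ 2 - a2 E - x1 - x2) + a2 E + x1 + x2); last by ring.
  by move: (l ^+ 2 - _ - _ - _) ix3 => z iz; pint_tac.
suff [my1 md] : pmax p y1 /\ pmax p (dcubic E x1).
  have := good k1; rewrite -h1 expr2 md => /(_ (pmaxMr p_pr my1 iy1)).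
  by [].
move: il; rewrite /l /slope; case: eqVneq => [e|n12] il.
  move: ne; rewrite e eqxx /= => ne; subst x2.
  have [e y10] := same_abscissa h1 h2' ne.
  have m2 : pmax p (2 * y1).
    by rewrite (_ : 2 * y1 = y1 - y2) // -[y2]opprK e; ring.
  have n2y : 2 * y1 != 0 by rewrite mulf_neq0.
  split; last by rewrite -[dcubic E x1](divfK n2y); apply: pmaxM.
  have -> : y1 = 2^-1 * (2 * y1) by field.
  exact: pmaxM.
have n21 : x2 - x1 != 0 by rewrite subr_eq0 eq_sym.
have m12 : x1 - x2 != 0 by rewrite subr_eq0.
set k : rat := (- y2 - y1) / (x2 - x1) in il *.
have ms : pmax p (y1 + y2).
  rewrite (_ : y1 + y2 = k * (x1 - x2)); first exact: pmaxM.
  by rewrite /k; field.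
have my1 : pmax p y1.
  rewrite (_ : y1 = 2^-1 * ((y1 + y2) + (y1 - y2))); last by field.
  by apply: pmaxM => //; apply: pmaxD.
split=> //.
have -> : dcubic E x1 = k * (y1 - y2) + (x1 - x2) * (2 * x1 + x2 + a2 E).
  have -> : k * (y1 - y2) = (y1 ^+ 2 - y2 ^+ 2) / (x1 - x2).
    by rewrite /k; field; rewrite n21 m12.
  by rewrite h1 h2 /cubic /dcubic; field; rewrite m12.
apply: pmaxD => //; first exact: pmaxM.
by apply: pmaxMr => //; pint_tac.
Qed.

(** The residue modulo p, meaningful for p-integral x only. *)
Definition res (x : rat) : 'F_p := (numq x)%:~R / (denq x)%:~R.

Lemma intr_Fp_eq0 (z : int) : (z%:~R == 0 :> 'F_p) = (p %| `|z|)%N.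
Proof.
rewrite (dvdn_pcharf (pchar_Fp p_pr)).
by case: z => k //; rewrite NegzE mulrNz oppr_eq0.
Qed.

Lemma pmax_res x y : pint p x -> pint p y -> res x = res y -> pmax p (x - y).
Proof.
move=> hx hy e.
have dx : ((denq x)%:~R : 'F_p) != 0 by rewrite intr_Fp_eq0.
have dy : ((denq y)%:~R : 'F_p) != 0 by rewrite intr_Fp_eq0.
have : ((numq x * denq y - numq y * denq x)%:~R : 'F_p) == 0.
  rewrite rmorphB !rmorphM /= subr_eq0; move/eqP: e; rewrite /res.
  by rewrite eqr_div.
rewrite intr_Fp_eq0 => /dvdnP[k ek].
have [z ez] : exists z : int, numq x * denq y - numq y * denq x = z * p%:Z.
  have : (p%:Z %| numq x * denq y - numq y * denq x)%Z by rewrite dvdzE ek dvdn_mull.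
  by case/dvdzP=> z ->; exists z.
have d0 x' : ((denq x')%:~R : rat) != 0 by rewrite intr_eq0 denq_neq0.
have p0 : (p%:R : rat) != 0 by rewrite pnatr_eq0 -lt0n prime_gt0.
rewrite /pmax (_ : _ / _ = z%:~R / (denq x * denq y)%:~R).
  by apply: pint_frac => //; rewrite abszM Euclid_dvdM // negb_or; apply/andP.
have := congr1 (fun z : int => z%:~R : rat) ez.
rewrite /= rmorphB !rmorphM /= => ez'.
rewrite (_ : x - y = (numq x)%:~R / (denq x)%:~R - (numq y)%:~R / (denq y)%:~R).
  apply: (mulIf p0); rewrite divfK //.
  rewrite -mulNr addf_div // mulNr ez' -[p%:~R]/(p%:R).
  by rewrite mulrAC.
by rewrite !divq_num_den.
Qed.

(** Pigeonhole: among the first p^2 + 1 multiples, either one is in the kernel, or two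
    have the same residues, and then their difference is in the kernel. *)
Lemma multiple_in_ker (P : ecpoint E) :
  exists2 m, (0 < m <= (p ^ 2).+1)%N & in_ker (P *+ m).
Proof.
have [/hasP[m]|/hasPn nK] := boolP (has (fun m => in_ker (pt (P *+ m))) (iota 1 (p ^ 2).+1)).
  by rewrite mem_iota add1n ltnS => hm kP; exists m.
have {}nK m : (0 < m <= (p ^ 2).+1)%N -> ~~ in_ker (pt (P *+ m)).
  by move=> hm; apply: nK; rewrite mem_iota add1n ltnS.
pose f (i : 'I_(p ^ 2).+1) : 'F_p * 'F_p :=
  if pt (P *+ i.+1) is Aff x y then (res x, res y) else (0, 0).
have /injectivePn[i [j]] : ~~ injectiveb f.
  apply/negP => /injectiveP /leq_card.
  by rewrite card_prod card_ord card_Fp // mulnn ltnn.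
wlog ltij : i j / (i < j)%N => [H ne e|ne e].
  have [l|l|/val_inj eij] := ltngtP i j; first exact: (H i j l ne e).
    by apply: (H j i l); rewrite 1?eq_sym.
  by rewrite eij eqxx in ne.
have hm : (0 < j - i <= (p ^ 2).+1)%N.
  by rewrite subn_gt0 ltij /= (leq_trans (leq_subr _ _)) // ltnW.
exists (j - i)%N => //.
have -> : P *+ (j - i) = P *+ j.+1 - P *+ i.+1 by rewrite -mulrnBr ?subSS // ltnS ltnW.
have ki := nK i.+1 (ltn_ord i); have kj := nK j.+1 (ltn_ord j).
move: e ki kj; rewrite /f ptD ptN.
have := ptP (P *+ i.+1); have := ptP (P *+ j.+1).
case: (pt (P *+ i.+1)) => [|x1 y1] //; case: (pt (P *+ j.+1)) => [|x2 y2] //.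
rewrite !on_curveE => /eqP h2 /eqP h1 e.
rewrite /in_ker !negbK => k1 k2.
apply: congruent_sub_in_ker => //; apply: pmax_res => //.
- exact: esym (congr1 fst e).
- exact: pint_ordinate h2 k2.
- exact: pint_ordinate h1 k1.
- exact: esym (congr1 snd e).
Qed.
End Reduction.

(** * A point of infinite order on the translate of E *)

Definition shifted_curve : wcurve rat := WCurve 4 324 0.

Lemma cubic_shifted x : cubic shifted_curve x = x * (x ^+ 2 + 4 * x + 324).
Proof. by rewrite /cubic /=; ring. Qed.

Lemma dcubic_shifted x : dcubic shifted_curve x = 3 * x ^+ 2 + 8 * x + 324.
Proof. by rewrite /dcubic /=; ring. Qed.

Lemma shifted_factor_gt0 (x : rat) : 0 < x ^+ 2 + 4 * x + 324.
Proof.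
rewrite (_ : _ + _ = (x + 2) ^+ 2 + 320); last by ring.
by rewrite ltr_wpDl // sqr_ge0.
Qed.

Lemma shifted_nonsingular : nonsingular shifted_curve.
Proof.
split=> // x; rewrite cubic_shifted dcubic_shifted => /eqP.
rewrite mulf_eq0 [_ + 324 == 0]gt_eqF ?shifted_factor_gt0 // orbF => /eqP->.
by rewrite expr0n !mulr0 !add0r.
Qed.

Definition shifted_ec := ECurve shifted_nonsingular.

Lemma generator_on : on_curve shifted_ec (Aff 9 63).
Proof. by rewrite on_curveE cubic_shifted; apply/eqP; ring. Qed.

Definition gen : ecpoint shifted_ec := ECPoint generator_on.

Lemma shifted_double (P : ecpoint shifted_ec) x y : pt P = Aff x y -> y != 0 ->
  exists y', pt (P + P) = Aff (((x ^+ 2 - 324) / (2 * y)) ^+ 2) y'.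
Proof.
move=> eP y0; have /eqP h : y ^+ 2 == cubic shifted_ec x by have := ptP P; rewrite eP on_curveE.
have ne : ~~ ((x == x) && (y == - y)).
  by rewrite eqxx /=; apply: contra y0 => /eqP e; apply/eqP; lra.
rewrite ptD eP (addp_aff _ ne) /slope eqxx.
exists (dcubic shifted_ec x / (2 * y) *
  (x - ((dcubic shifted_ec x / (2 * y)) ^+ 2 - a2 shifted_ec - x - x)) - y).
have ex : (dcubic shifted_ec x / (2 * y)) ^+ 2 - a2 shifted_ec - x - x =
          ((x ^+ 2 - 324) / (2 * y)) ^+ 2.
  rewrite /=; apply/eqP; rewrite -subr_eq0; apply/eqP.
  rewrite dcubic_shifted.
  rewrite (_ : _ - _ = ((3 * x ^+ 2 + 8 * x + 324) ^+ 2 - (x ^+ 2 - 324) ^+ 2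
     - 4 * (4 + 2 * x) * y ^+ 2) / (4 * y ^+ 2)); last by field.
  rewrite h cubic_shifted (_ : _ - _ = 0); last by ring.
  by rewrite mul0r.
by rewrite ex.
Qed.

Lemma shifted_doubleE (P : ecpoint shifted_ec) x y : pt P = Aff x y -> y != 0 ->
  exists y', pt (P + P) = Aff ((x ^+ 2 - 324) ^+ 2 / (4 * cubic shifted_ec x)) y'.
Proof.
move=> eP y0; have /eqP h : y ^+ 2 == cubic shifted_ec x by have := ptP P; rewrite eP on_curveE.
have [y' ->] := shifted_double eP y0; exists y'; congr Aff.
by rewrite -h; field.
Qed.

Lemma pint_primeV p : prime p -> forall q, prime q -> p != q -> pint p (q%:R^-1).
Proof. by move=> pp q pq npq; apply: pint_natV => //; rewrite dvdn_prime2. Qed.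

(** A Bezout identity for the cubic and its derivative, with constant 2^9 3^8 5. *)
Lemma shifted_good p : prime p -> p != 2 -> p != 3 -> p != 5 ->
  forall x, pint p x -> pmax p (cubic shifted_ec x) -> ~~ pmax p (dcubic shifted_ec x).
Proof.
move=> pp p2 p3 p5 x hx mc; apply/negP => md.
have e : (- (717 * x + 2398)) * cubic shifted_ec x
   + (239 * x ^+ 2 + 1118 * x + 2 ^+ 7 * 3 ^+ 4 * 5) * dcubic shifted_ec x
   = 2 ^+ 9 * 3 ^+ 8 * 5.
  by rewrite cubic_shifted dcubic_shifted; ring.
have iV := pint_primeV pp.
have m1 : pmax p (2 ^+ 9 * 3 ^+ 8 * 5).
  by rewrite -e; apply: (pmaxD pp); apply: (pmaxM pp); [pint_tac|exact: mc|pint_tac|exact: md].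
clear e; have := pmaxM pp (pintM pp (pintM pp (pintX pp 9 (iV 2 isT p2))
   (pintX pp 8 (iV 3 isT p3))) (iV 5 isT p5)) m1.
rewrite (_ : _ * _ = 1); last by field.
by apply/negP; apply: pmax1.
Qed.

(** Otherwise 1 would be in the maximal ideal. *)
Lemma not_pint p z d k : prime p -> pint p d -> pint p k ->
  z * d * p%:R = 1 + k * p%:R -> ~~ pint p z.
Proof.
move=> pp hd hk e; apply/negP => hz.
have p0 : (p%:R : rat) != 0 by rewrite pnatr_eq0 -lt0n prime_gt0.
have mp u : pint p u -> pmax p (u * p%:R) by rewrite /pmax mulfK.
have := pmaxB pp (mp _ (pintM pp hz hd)) (mp _ hk).
by rewrite e addrK; apply/negP; apply: pmax1.
Qed.

Lemma pt_double_gen :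
  pt (gen + gen) = Aff (3 ^+ 6 * 196^-1) (71 / 14 * (9 - 3 ^+ 6 * 196^-1) - 63).
Proof.
have ne : ~~ ((9 == 9 :> rat) && (63 == - 63 :> rat)) by [].
rewrite ptD [pt gen]/= (addp_aff _ ne) /slope eqxx dcubic_shifted /=.
by congr Aff; field.
Qed.

Lemma in_kerE p x y : in_ker p (Aff x y) = ~~ pint p x. Proof. by []. Qed.

Lemma in_ker2_gen2 : in_ker 2 (pt (gen *+ 2)).
Proof.
have p2 : prime 2 by [].
rewrite mulr2n pt_double_gen in_kerE.
apply: (@not_pint 2 _ 98 364 p2 (pint_nat p2 98) (pint_nat p2 364)).
by field.
Qed.

Lemma chord_in_ker (E : wcurve rat) p x1 y1 x2 y2 : prime p ->
  pint p (a2 E) -> pint p x1 -> pint p x2 -> x1 != x2 ->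
  ~~ pint p ((y2 - y1) / (x2 - x1)) -> in_ker p (addp E (Aff x1 y1) (Aff x2 y2)).
Proof.
move=> pp h2 h1 hx2 n12 nl.
have ne : ~~ ((x1 == x2) && (y1 == - y2)) by rewrite (negPf n12).
rewrite (addp_aff _ ne) /slope (negPf n12) /in_ker; apply: contra nl.
move: (_ / _) => l h; apply: (@pint_root _ pp _ 1).
have -> : l ^+ 2 = l ^+ 2 - a2 E - x1 - x2 + a2 E + x1 + x2 by ring.
by move: (l ^+ 2 - _ - _ - _) h => u hu; pint_tac.
Qed.

(** The slope of the line through 2 gen and gen is 30251 / 1610, where 1610 = 5 * 322 and
    30251 = 1 + 5 * 6050. *)
Lemma in_ker5_gen3 : in_ker 5 (pt (gen *+ 3)).
Proof.
have p5 : prime 5 by [].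
have i4 : pint 5 (a2 shifted_ec) := pint_nat p5 4.
have i9 : pint 5 9 := pint_nat p5 9.
have n9 : 3 ^+ 6 * 196^-1 != 9 :> rat by [].
have i196 : pint 5 (196^-1) by apply: pint_natV.
have i2 : pint 5 (3 ^+ 6 * 196^-1) by pint_tac.
have nl : ~~ pint 5 ((63 - (71 / 14 * (9 - 3 ^+ 6 * 196^-1) - 63)) / (9 - 3 ^+ 6 * 196^-1)).
  apply: (@not_pint 5 _ 322 (2 * 5 ^+ 2 * 11 ^+ 2) p5); [by pint_tac|by pint_tac|].
  by field.
by rewrite mulrSr mulr2n ptD pt_double_gen; exact: (chord_in_ker p5 i4 i2 i9 n9 nl).
Qed.

Lemma not_pint3_aux (b M D k : rat) : pint 3 b -> b != 0 -> D != 0 ->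
  pint 3 D -> pint 3 k -> M ^+ 2 = 1 + k * 3 ->
  ~~ pint 3 ((81 * M) ^+ 2 / (4 * (3 ^+ 10 * b * D))).
Proof.
move=> ib b0 D0 iD ik eM; have p3 : prime 3 by [].
have i12 : pint 3 (12 * b * D) by pint_tac.
apply: (not_pint p3 i12 ik); rewrite -eM.
by field; rewrite b0 D0.
Qed.

(** In the duplication formula at 3^6 b, the numerator is 3^8 times a unit at 3, since
    324 = 3^4 * 4, and the denominator is 3^10 times a 3-integral number. *)
Lemma not_pint3_double (b : rat) : pint 3 b -> b != 0 ->
  ~~ pint 3 (((3 ^+ 6 * b) ^+ 2 - 324) ^+ 2 / (4 * cubic shifted_ec (3 ^+ 6 * b))).
Proof.
move=> ib b0; have p3 : prime 3 by [].
have c0 : 3 ^+ 8 * b ^+ 2 + 36 * b + 4 != 0.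
  have k81 : 0 < 81 :> rat by [].
  have := shifted_factor_gt0 (3 ^+ 6 * b).
  rewrite (_ : _ + 324 = 81 * (3 ^+ 8 * b ^+ 2 + 36 * b + 4)); last by ring.
  by rewrite (pmulr_rgt0 _ k81) => h; rewrite (gt_eqF h).
have -> : cubic shifted_ec (3 ^+ 6 * b) =
          3 ^+ 10 * b * (3 ^+ 8 * b ^+ 2 + 36 * b + 4) by rewrite cubic_shifted; ring.
have -> : (3 ^+ 6 * b) ^+ 2 - 324 = 81 * (3 ^+ 8 * b ^+ 2 - 4) by ring.
have eM : (3 ^+ 8 * b ^+ 2 - 4) ^+ 2 =
          1 + (5 + 3 ^+ 15 * b ^+ 4 - 8 * 3 ^+ 7 * b ^+ 2) * 3 by ring.
have iD : pint 3 (3 ^+ 8 * b ^+ 2 + 36 * b + 4) by pint_tac.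
have ik : pint 3 (5 + 3 ^+ 15 * b ^+ 4 - 8 * 3 ^+ 7 * b ^+ 2) by pint_tac.
exact: (not_pint3_aux ib b0 c0 iD ik eM).
Qed.

Lemma in_ker3_gen4 : in_ker 3 (pt (gen *+ 4)).
Proof.
have p3 : prime 3 by [].
have e4 : gen *+ 4 = (gen + gen) + (gen + gen) by rewrite -[gen + gen]mulr2n -mulrnDr.
have y0 : 71 / 14 * (9 - 3 ^+ 6 * 196^-1) - 63 != 0 :> rat by [].
have [y' e] := shifted_doubleE pt_double_gen y0.
have ib : pint 3 (196^-1) by apply: pint_natV.
have b0 : 196^-1 != 0 :> rat by [].
by rewrite e4 e in_kerE; exact: not_pint3_double ib b0.
Qed.

(** At the primes 2, 3 and 5 of bad reduction, 2 gen, 4 gen and 3 gen are in the kernel;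
    the pigeonhole deals with the others. *)
Lemma multiple_gen_in_ker p : prime p ->
  exists2 m, (0 < m <= (p ^ 2).+1)%N & in_ker p (pt (gen *+ m)).
Proof.
move=> pp.
have [->|p2] := eqVneq p 2; first by exists 2; rewrite ?in_ker2_gen2.
have [->|p3] := eqVneq p 3; first by exists 4; rewrite ?in_ker3_gen4.
have [->|p5] := eqVneq p 5; first by exists 3; rewrite ?in_ker5_gen3.
apply: multiple_in_ker => //; try exact: pint_nat.
  exact: pint0.
exact: shifted_good.
Qed.

Lemma punit_1add p a : prime p -> pmax p a ->
  [/\ 1 + a != 0, pint p (1 + a) & pint p (1 + a)^-1].
Proof.
move=> pp ma; have [n0 iv] := pmax_1addV pp ma; split=> //.
by apply: (pintD pp (pint1 pp) (pmax_pint pp ma)).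
Qed.

Definition punit p u := [/\ u != 0, pint p u & pint p u^-1].

Lemma punitM p u v : prime p -> punit p u -> punit p v -> punit p (u * v).
Proof.
move=> pp [u0 iu iuv] [v0 iv ivv]; split; first exact: mulf_neq0.
  exact: pintM.
by rewrite invfM; exact: pintM.
Qed.

Lemma punitV p u : punit p u -> punit p u^-1.
Proof. by case=> u0 iu iv; split; rewrite ?invr_eq0 ?invrK. Qed.

Lemma double_inv_aux (F : fieldType) (w a b : F) : (4 : F) != 0 ->
  w != 0 -> a != 0 -> b != 0 ->
  ((w^-1 ^+ 2 * b) ^+ 2 / (4 * (w^-1 ^+ 3 * a)))^-1 = 4 * w * (a * (b^-1 * b^-1)).
Proof. by move=> k0 w0 a0 b0; field; rewrite a0 b0 w0. Qed.

(** In terms of w = 1 / x, doubling is w |-> 4 w (1 + 4 w + 324 w^2) / (1 - 324 w^2)^2. *)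
Lemma double_in_ker2 (P : ecpoint shifted_ec) x y : pt P = Aff x y -> ~~ pint 2 x ->
  exists x' y' u, [/\ pt (P + P) = Aff x' y', x'^-1 = 4 * x^-1 * u & punit 2 u].
Proof.
move=> eP nx; have p2 : prime 2 by [].
have x0 : x != 0 by apply: contraNneq nx => ->; apply: (pint0 p2).
pose w := x^-1; have mw : pmax 2 w by apply: pmax_inv.
have iw := pmax_pint p2 mw.
have ew : x = w^-1 by rewrite /w invrK.
have w0 : w != 0 by rewrite invr_eq0.
have ma : pmax 2 (4 * w + 324 * w ^+ 2).
  have -> : 4 * w + 324 * w ^+ 2 = (4 + 324 * w) * w by ring.
  by apply: (pmaxM p2 _ mw); pint_tac.
have mb : pmax 2 (- (324 * w ^+ 2)).
  have -> : - (324 * w ^+ 2) = - (324 * w) * w by ring.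
  by apply: (pmaxM p2 _ mw); pint_tac.
have ua := punit_1add p2 ma; have ub := punit_1add p2 mb.
have [a0 _ _] := ua; have [b0 _ _] := ub.
have /eqP h : y ^+ 2 == cubic shifted_ec x by have := ptP P; rewrite eP on_curveE.
have ec : cubic shifted_ec x = x ^+ 3 * (1 + (4 * w + 324 * w ^+ 2)).
  by rewrite cubic_shifted ew; field.
have y0 : y != 0.
  by rewrite -sqrf_eq0 h ec; exact: (mulf_neq0 (expf_neq0 3 x0) a0).
have [y' e] := shifted_doubleE eP y0.
exists ((x ^+ 2 - 324) ^+ 2 / (4 * cubic shifted_ec x)), y'.
exists ((1 + (4 * w + 324 * w ^+ 2)) * ((1 + - (324 * w ^+ 2))^-1 * (1 + - (324 * w ^+ 2))^-1)).
split; first exact: e; last first.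
  by apply: (punitM p2 ua); apply: (punitM p2); apply: punitV.
have -> : (x ^+ 2 - 324) = x ^+ 2 * (1 + - (324 * w ^+ 2)) by rewrite ew; field.
by rewrite ec -/w ew; exact: double_inv_aux.
Qed.

Lemma shifted_in_kerMn p (P : ecpoint shifted_ec) m : prime p ->
  in_ker p P -> in_ker p (pt (P *+ m)).
Proof.
move=> pp; have i2 : pint p (a2 shifted_ec) := pint_nat pp 4.
have i4 : pint p (a4 shifted_ec) := pint_nat pp 324.
have i6 : pint p (a6 shifted_ec) := pint0 pp.
exact: (in_kerMn pp i2 i4 i6).
Qed.

Lemma iter_double_in_ker2 (P : ecpoint shifted_ec) x0 y0 j : pt P = Aff x0 y0 -> ~~ pint 2 x0 ->
  exists x y u,
    [/\ pt (P *+ (2 ^ j)) = Aff x y, x^-1 = 4 ^+ j * x0^-1 * u & punit 2 u].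
Proof.
have p2 : prime 2 by [].
move=> e0 nx0; elim: j => [|j [x [y [u [e ex pu]]]]].
  exists x0, y0, 1; rewrite expn0 mulr1n expr0 mul1r mulr1.
  by split=> //; split; rewrite ?invr1 ?oner_eq0 //; exact: pint1.
have : in_ker 2 (pt (P *+ 2 ^ j)).
  by apply: (shifted_in_kerMn _ p2); rewrite e0.
rewrite e in_kerE => nx.
have [x' [y' [v [e' ex' pv]]]] := double_in_ker2 e nx.
exists x', y', (u * v); split; last exact: punitM.
  by rewrite expnS mulnC mulrnA mulr2n.
by rewrite ex' ex exprS; ring.
Qed.

(** The abscissas of the points 2^j P have pairwise different 2-adic valuations, whereas
    those of a torsion point would repeat, as 2^j does modulo its order. *)
Lemma in_ker2_nontorsion (P : ecpoint shifted_ec) x0 y0 m :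
  pt P = Aff x0 y0 -> ~~ pint 2 x0 -> (0 < m)%N -> P *+ m != 0.
Proof.
move=> e0 nx0 m0; apply/eqP => eP.
have p2 : prime 2 by [].
have Pmod k : P *+ k = P *+ (k %% m).
  by rewrite [in LHS](divn_eq k m) mulrnDr mulnC mulrnA eP mul0rn add0r.
have /injectivePn[i [j]] : ~~ injectiveb (fun i : 'I_m.+1 => Ordinal (ltn_pmod (2 ^ i) m0)).
  by apply/negP => /injectiveP /leq_card; rewrite !card_ord ltnn.
move=> nij /(congr1 val) /= eij.
have {Pmod} eD : P *+ 2 ^ i = P *+ 2 ^ j by rewrite Pmod eij -Pmod.
wlog ltij : i j nij eD eij / (i < j)%N => [W|].
  have [l|l|/val_inj e] := ltngtP i j; first exact: (W i j).
    by apply: (W j i); rewrite // eq_sym.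
  by rewrite e eqxx in nij.
have [x [y [u [e ex [u0 iu iuV]]]]] := iter_double_in_ker2 i e0 nx0.
have [x' [y' [v [e' ex' [v0 iv ivV]]]]] := iter_double_in_ker2 j e0 nx0.
have exx : x = x' by move: e; rewrite eD e' => -[].
have k0 : x0^-1 != 0.
  by rewrite invr_eq0; apply: contraNneq nx0 => ->; exact: (pint0 p2).
have eu : u = 4 ^+ (j - i) * v.
  move: ex'; rewrite -exx ex -{1}(subnK (ltnW ltij)) exprD.
  move: (x0^-1) k0 => k k0 e2.
  have k4 : (4 : rat) ^+ i * k != 0 by apply: (mulf_neq0 (expf_neq0 i _) k0).
  by apply: (mulfI k4); rewrite e2; ring.
have : pmax 2 1.
  rewrite -(mulfV u0) {1}eu; apply: (pmaxMr p2 _ iuV); apply: (pmaxMr p2 _ iv).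
  have ji0 : (0 < j - i)%N by rewrite subn_gt0.
  rewrite -(prednK ji0) exprS; apply: (pmaxMr p2); last first.
    by apply: (pintX p2); exact: (pint_nat p2 4).
  by rewrite /pmax (_ : 4 / 2 = 2) //; exact: (pint_nat p2 2).
by apply/negP; apply: pmax1.
Qed.

Lemma gen_nontorsion m : (0 < m)%N -> gen *+ m != 0.
Proof.
move=> m0; have k2 := in_ker2_gen2; have e2 := pt_double_gen.
rewrite mulr2n e2 in_kerE in k2.
apply: contraTneq (in_ker2_nontorsion e2 k2 m0) => em.
by rewrite negbK -mulr2n -mulrnA mulnC mulrnA em mul0rn.
Qed.

(** * From points of E to curves with three independent points *)

Lemma concordant_rat (u x y v : rat) :
  u ^+ 2 + x ^+ 2 = y ^+ 2 -> u ^+ 2 + 4 * x ^+ 2 = v ^+ 2 -> u * x = 0.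
Proof.
move=> e1 e2.
pose D := denq u * denq x * denq y * denq v.
have D0 : (D%:~R : rat) != 0 by rewrite intr_eq0 !mulf_neq0 ?denq_neq0.
have toint z : z \in [:: u; x; y; v] -> exists k : int, z * D%:~R = k%:~R.
  have zE q : q * (denq q)%:~R = (numq q)%:~R by rewrite numqE.
  rewrite /D !inE => /or4P[] /eqP->; rewrite !intrM.
  - exists (numq u * denq x * denq y * denq v); rewrite !intrM -zE; ring.
  - exists (denq u * numq x * denq y * denq v); rewrite !intrM -zE; ring.
  - exists (denq u * denq x * numq y * denq v); rewrite !intrM -zE; ring.
  - exists (denq u * denq x * denq y * numq v); rewrite !intrM -zE; ring.
have [|u' eu] := toint u; first by rewrite !inE eqxx.
have [|x' ex] := toint x; first by rewrite !inE eqxx ?orbT.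
have [|y' ey] := toint y; first by rewrite !inE eqxx ?orbT.
have [|v' ev] := toint v; first by rewrite !inE eqxx ?orbT.
have f1 : u' ^+ 2 + x' ^+ 2 = y' ^+ 2.
  apply: (@intr_inj rat); rewrite !(rmorphD, rmorphXn) /= -eu -ex -ey.
  by rewrite !exprMn -e1; ring.
have f2 : u' ^+ 2 + 4 * x' ^+ 2 = v' ^+ 2.
  apply: (@intr_inj rat); rewrite rmorphD rmorphM !rmorphXn /= -eu -ex -ev.
  by rewrite !exprMn -e2; ring.
have sqE (k : int) : k ^+ 2 = ((`|k| ^ 2)%N)%:Z by rewrite -abszX gez0_abs ?sqr_ge0.
have : (`|u'| * `|x'|)%N = 0%N.
  apply: (@euler_concordant _ _ `|y'| `|v'|); apply/eqP; rewrite -eqz_nat PoszD.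
    by rewrite -!sqE f1.
  by rewrite PoszM -!sqE f2.
move=> /eqP; rewrite -abszM absz_eq0 => /eqP e.
have : (u * D%:~R) * (x * D%:~R) = 0 by rewrite eu ex -intrM e.
move/eqP; rewrite !mulf_eq0 (negPf D0) !orbF => /orP[] /eqP ->.
  by rewrite mul0r.
by rewrite mulr0.
Qed.

(** If (t^2 + 2)(2 t^2 + 1) = z^2 then U = t^4 - 1 and V = t z satisfy
    U^2 + V^2 = (t^4 + t^2 + 1)^2 and U^2 + 4 V^2 = (t^4 + 4 t^2 + 1)^2. These formulas are the
    duplication on y^2 = x (x + 1)(x + 4), at x = 2 t^2. *)
Lemma quartic_not_square (t z : rat) : 0 < t ^+ 2 - 1 ->
  (t ^+ 2 + 2) * (2 * t ^+ 2 + 1) <> z ^+ 2.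
Proof.
move=> ht e.
have : (t ^+ 4 - 1) * (t * z) = 0.
  apply: (@concordant_rat _ _ (t ^+ 4 + t ^+ 2 + 1) (t ^+ 4 + 4 * t ^+ 2 + 1)).
    by rewrite [in LHS]exprMn -e; ring.
  by rewrite [(t * z) ^+ 2]exprMn -e; ring.
have t20 : 0 <= t ^+ 2 by apply: sqr_ge0.
have -> : t ^+ 4 - 1 = (t ^+ 2 - 1) * (t ^+ 2 + 1) by ring.
move/eqP; rewrite !mulf_eq0 gt_eqF //= gt_eqF ?ltr_wpDl //=.
case/orP=> /eqP h0; first by move: ht; rewrite h0 expr0n.
move/eqP: e; rewrite h0 expr0n /= mulf_eq0 !gt_eqF ?ltr_wpDl //.
by rewrite mulr_ge0.
Qed.

(* A point (X, Y) of the translate with X a square (it is a double) and in the kernel of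
    reduction modulo 2. In the names below, A, B, C are the factors of n = 3 A B C. *)
Section FromPoint.
Variables X Y g : rat.
Hypothesis hXY : Y ^+ 2 = X * (X ^+ 2 + 4 * X + 324).
Hypothesis hg : X = g ^+ 2.
Hypothesis nX : ~~ pint 2 X.
Let p2 : prime 2. Proof. by []. Qed.
Let x := X - 18.
Let t := t_of x.

Let X0 : X != 0. Proof. by apply: contraNneq nX => ->; exact: (pint0 p2). Qed.
Lemma param_x_neq0 : x != 0.
Proof.
rewrite /x subr_eq0; apply: contraNneq nX => ->; exact: (pint_nat p2 18).
Qed.

Lemma param_on_curveE : on_curve curveE (Aff x Y).
Proof. by rewrite on_curveE hXY /cubic /x; apply/eqP; rewrite /=; ring. Qed.

Lemma param_tE : t = - (X + 18) / x.
Proof. by rewrite /t /t_of /x; congr (- _ / _); ring. Qed.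

Let g0 : g != 0. Proof. by move: X0; rewrite hg sqrf_eq0. Qed.
Let a := 6 * g / x.
Lemma param_a_neq0 : a != 0.
Proof. exact: (mulf_neq0 (mulf_neq0 (isT : (6 : rat) != 0) g0) (invr_neq0 param_x_neq0)). Qed.

(** A = 72 X / x^2, and X is a square. *)
Lemma param_AE : t ^+ 2 - 1 = 2 * a ^+ 2.
Proof.
have x0 := param_x_neq0.
have -> : 2 * a ^+ 2 = 72 * X / x ^+ 2 by rewrite /a hg; field.
rewrite param_tE; have -> : X = x + 18 by rewrite /x; ring.
by field.
Qed.

Lemma param_wE : (36 * Y / x ^+ 2) ^+ 2 = 2 * (t ^+ 2 - 1) * (5 * t ^+ 2 + 4).
Proof.
have x0 := param_x_neq0.
rewrite expr_div_n exprMn hXY param_tE; have -> : X = x + 18 by rewrite /x; ring.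
by field.
Qed.

(** Written in terms of 1 / X, which is small at the primes where (X, Y) reduces to
    the origin: there B is 3 times a unit times a square. *)
Lemma param_BE : t ^+ 2 + 2 = 3 * (1 + (324 * X^-1 - 12) * X^-1) * (X / x) ^+ 2.
Proof.
have x0 := param_x_neq0; have Xn := X0.
rewrite param_tE; apply: (mulIf (expf_neq0 2 x0)); move: Xn; rewrite /x in x0 * => Xn.
by field; rewrite Xn x0.
Qed.

Lemma param_CE : 2 * t ^+ 2 + 1 = 3 * (1 + (324 * X^-1 + 12) * X^-1) * (X / x) ^+ 2.
Proof.
have x0 := param_x_neq0; have Xn := X0.
rewrite param_tE; apply: (mulIf (expf_neq0 2 x0)); move: Xn; rewrite /x in x0 * => Xn.
by field; rewrite Xn x0.
Qed.

Lemma param_pmax p (c : rat) : prime p -> ~~ pint p X -> pint p c ->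
  pmax p ((324 * X^-1 + c) * X^-1).
Proof.
move=> pp nx ic; have mw := pmax_inv pp nx; have iw := pmax_pint pp mw.
by apply: (pmaxM pp _ mw); pint_tac.
Qed.

Let Xx0 : (X / x) ^+ 2 != 0.
Proof. exact: (expf_neq0 2 (mulf_neq0 X0 (invr_neq0 param_x_neq0))). Qed.

Lemma param_oddv p (c : rat) : prime p -> ~~ pint p X -> pint p c ->
  oddv p (3 * (1 + (324 * X^-1 + c) * X^-1) * (X / x) ^+ 2) = oddv p 3.
Proof.
move=> pp nx ic; have m := param_pmax pp nx ic; have [n0 _ _] := punit_1add pp m.
have k3 : (3 : rat) != 0 by [].
rewrite (oddvM3 p k3 n0 Xx0) oddv_sqr (oddv_1add pp m).
by rewrite !addbF.
Qed.

Let n := n_of t.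
Lemma param_arises : arises_from_E n.
Proof. exists x, Y; split; [exact: param_on_curveE|exact: param_x_neq0|by []]. Qed.

Lemma param_a2_gt0 : 0 < a ^+ 2.
Proof. by rewrite lt_neqAle sqr_ge0 andbT eq_sym; exact: (expf_neq0 2 param_a_neq0). Qed.

Lemma param_A_gt0 : 0 < t ^+ 2 - 1.
Proof.
rewrite param_AE; exact: (mulr_gt0 (ltr0Sn rat 1) param_a2_gt0).
Qed.

Definition param_BC := (t ^+ 2 + 2) * (2 * t ^+ 2 + 1).

Lemma param_nE : n = 6 * a ^+ 2 * param_BC.
Proof.
have -> : 6 * a ^+ 2 = 3 * (t ^+ 2 - 1) by rewrite param_AE; ring.
by rewrite /n /n_of /param_BC; ring.
Qed.

Lemma param_BC_gt0 : 0 < param_BC.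
Proof.
have t2 : 0 <= t ^+ 2 := sqr_ge0 t.
apply: mulr_gt0; first exact: (ltr_wpDl t2 (ltr0Sn rat 1)).
exact: (ltr_wpDl (mulr_ge0 (ler0n rat 2) t2) ltr01).
Qed.

Lemma param_n_gt0 : 0 < n.
Proof.
by rewrite param_nE; exact: (mulr_gt0 (mulr_gt0 (ltr0Sn rat 5) param_a2_gt0) param_BC_gt0).
Qed.

Lemma param_indep : has_three_indep_points (congruent_curve n).
Proof.
have i12 : pint 2 12 := pint_nat p2 12.
have [_ v3 _ _] := oddv2_small.
apply: (three_independent_points param_a_neq0 param_AE param_wE).
- by rewrite param_BE (param_oddv p2 nX (pintN i12)).
- by rewrite param_CE (param_oddv p2 nX i12).
- by move=> z; apply: quartic_not_square; exact: param_A_gt0.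
Qed.

Lemma param_BC_even p : prime p -> ~~ pint p X -> oddv p param_BC = false.
Proof.
move=> pp nx; have i12 : pint p 12 := pint_nat pp 12.
have /andP[B0 C0] : (t ^+ 2 + 2 != 0) && (2 * t ^+ 2 + 1 != 0).
  by rewrite -negb_or -mulf_eq0; apply: lt0r_neq0; exact: param_BC_gt0.
rewrite /param_BC (oddvM p B0 C0) param_BE param_CE.
by rewrite (param_oddv pp nx (pintN i12)) (param_oddv pp nx i12) addbb.
Qed.

Lemma param_BC_not_square z : param_BC <> z ^+ 2.
Proof. by apply: quartic_not_square; exact: param_A_gt0. Qed.

End FromPoint.

(** * A sequence of points with pairwise nonisomorphic curves *)

Definition abscissa (P : point rat) : rat := if P is Aff x _ then x else 0.

Definition t_mult m : rat := t_of (abscissa (pt (gen *+ m + gen *+ m)) - 18).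

Definition BC_mult m : rat := param_BC (abscissa (pt (gen *+ m + gen *+ m))).

Lemma good_multiple m : (0 < m)%N -> in_ker 2 (pt (gen *+ m)) ->
  exists X Y g, [/\ pt (gen *+ m + gen *+ m) = Aff X Y,
    Y ^+ 2 = X * (X ^+ 2 + 4 * X + 324), X = g ^+ 2 & ~~ pint 2 X].
Proof.
move=> m0 k2; have p2 : prime 2 by [].
have := gen_nontorsion m0; have m20 : (0 < m * 2)%N by rewrite muln_gt0 m0.
have := gen_nontorsion m20; rewrite mulrnA mulr2n.
have : in_ker 2 (pt (gen *+ m + gen *+ m)).
  by rewrite -mulr2n; exact: (shifted_in_kerMn _ p2 k2).
move: (gen *+ m) => R k4 n2 n1.
case eR : (pt R) => [|x y]; first by case/eqP: n1; apply: val_inj.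
have y0 : y != 0.
  apply: contraNneq n2 => y0; apply/eqP/val_inj.
  by apply: (etrans (ptD R R)); rewrite eR y0 /addp oppr0 !eqxx.
have [Y eS] := shifted_double eR y0.
set g := (x ^+ 2 - 324) / (2 * y) in eS.
exists (g ^+ 2), Y, g; split=> //.
  have := ptP (R + R); rewrite eS => /eqP ->.
  by rewrite -cubic_shifted.
by move: k4; rewrite eS.
Qed.

(** Each term divides the next one, and with the factorial the next one becomes a
    multiple of all numbers up to p^2 + 1, for the primes p dividing the numerator or
    denominator of B C at the present term. *)
Fixpoint mult_seq k : nat :=
  if k is k'.+1 then
    let m := mult_seq k' in
    (m * ((`|numq (BC_mult m)| * `|denq (BC_mult m)|) ^ 2).+1`!)%N
  else 2.

Lemma mult_seq_gt0 k : (0 < mult_seq k)%N.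
Proof. by elim: k => //= k IH; rewrite muln_gt0 IH fact_gt0. Qed.

Lemma mult_seq_dvd i j : (i <= j)%N -> (mult_seq i %| mult_seq j)%N.
Proof.
elim: j => [|j IH]; first by rewrite leqn0 => /eqP ->.
rewrite leq_eqVlt => /orP[/eqP -> //|]; rewrite ltnS => /IH h.
exact: (dvdn_mulr _ h).
Qed.

Lemma in_ker_dvd p k m : prime p -> (k %| m)%N ->
  in_ker p (pt (gen *+ k)) -> in_ker p (pt (gen *+ m)).
Proof.
move=> pp /dvdnP[c ->] h; rewrite mulnC mulrnA; exact: (shifted_in_kerMn _ pp h).
Qed.

Lemma mult_seq_in_ker2 k : in_ker 2 (pt (gen *+ mult_seq k)).
Proof.
have p2 : prime 2 by [].
exact: (in_ker_dvd p2 (mult_seq_dvd (leq0n k)) in_ker2_gen2).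
Qed.

(** By [multiple_gen_in_ker] some m <= p^2 + 1 has m gen in the kernel at p, and m
    divides the later terms of the sequence. *)
Lemma mult_seq_in_ker i j p : (i < j)%N -> prime p -> oddv p (BC_mult (mult_seq i)) ->
  in_ker p (pt (gen *+ mult_seq j)).
Proof.
move=> ij pp od; have [m /andP[m0 mp] km] := multiple_gen_in_ker pp.
apply: (in_ker_dvd pp _ km); apply: dvdn_trans (mult_seq_dvd ij).
have hp := oddv_leq od.
apply: dvdn_mull; apply: dvdn_fact; rewrite m0 (leq_trans mp) //.
by rewrite ltnS leq_sqr.
Qed.

Lemma x4_point x y : x != 0 -> y ^+ 2 = cubic curveE x -> exists Y : rat,
  on_curve (congruent_curve (n_of (t_of x))) (Aff (x4_of (t_of x)) Y).
Proof.
move=> x0 h; have et : t_of x = - (x + 36) / x by [].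
move: (t_of x) et => t et.
have ew : (36 * y / x ^+ 2) ^+ 2 = 2 * (t ^+ 2 - 1) * (5 * t ^+ 2 + 4).
  by rewrite expr_div_n exprMn h et /cubic /=; field.
have ex4 : x4_of t = 6 * (t ^+ 2 - 1) * (2 * t ^+ 2 + 1) ^+ 2.
  by rewrite /x4_of; ring.
exists (9 * t * (t ^+ 2 - 1) * (2 * t ^+ 2 + 1) ^+ 2 * (36 * y / x ^+ 2)).
rewrite ex4; exact: curve_pt3 ew.
Qed.

Lemma cancel_squares (F : fieldType) (q r k a b : F) :
  k != 0 -> a != 0 -> b != 0 ->
  q * r = (k * a ^+ 2 * q) * (k * b ^+ 2 * r) / (k * a * b) ^+ 2.
Proof. by move=> k0 a0 b0; field; rewrite k0 a0 b0. Qed.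

(** A twist by u^2 multiplies n^2 by u^4; translations are excluded as both cubics have
    no square term. *)
Lemma congruent_iso_sqr (n m : rat) : 0 < n -> 0 < m ->
  wcurve_iso (congruent_curve n) (congruent_curve m) -> exists u, n * m = u ^+ 2.
Proof.
move=> n0 m0 [u [r [u0 /= e2 e4 _]]]; exists (u * m).
have r0 : r = 0 by move: e2; rewrite mulr0 add0r => e2; lra.
have : n ^+ 2 == (u ^+ 2 * m) ^+ 2.
  move: e4; rewrite r0 => e4; apply/eqP.
  apply: oppr_inj; transitivity (u ^+ 4 * - m ^+ 2); last by ring.
  by rewrite e4; ring.
have un : 0 < u ^+ 2 * m.
  by apply: mulr_gt0 m0; rewrite lt_neqAle sqr_ge0 andbT eq_sym; exact: expf_neq0.
rewrite eqf_sqr => /orP[] /eqP e; first by rewrite e; ring.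
by move: n0; rewrite e oppr_gt0 ltNge ltW.
Qed.

Theorem mainTheorem5 :
  (forall x y : rat,
     on_curve curveE (Aff x y) -> x != 0 -> n_of (t_of x) != 0 ->
     exists Y : rat,
       on_curve (congruent_curve (n_of (t_of x))) (Aff (x4_of (t_of x)) Y))
  /\
  (exists N : nat -> rat,
     (forall i : nat,
        [/\ arises_from_E (N i), N i != 0
          & has_three_indep_points (congruent_curve (N i))])
     /\
     (forall i j : nat, i <> j ->
        ~ wcurve_iso (congruent_curve (N i)) (congruent_curve (N j)))).
Proof.
split.
  move=> x y h x0 _; exact: x4_point x0 (eqP h).
exists (fun k => n_of (t_mult (mult_seq k))); split.
  move=> i; have [X [Y [g [e h1 h2 h3]]]] :=
    good_multiple (mult_seq_gt0 i) (mult_seq_in_ker2 i).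
  rewrite /t_mult e [abscissa _]/=.
  split; first exact: (param_arises h1 h3).
    exact: lt0r_neq0 (param_n_gt0 h2 h3).
  exact: (param_indep h1 h2 h3).
pose n k := n_of (t_mult (mult_seq k)).
(* A prime p with odd exponent in B C at step i has even exponent in B C at step j. *)
have main i j : (i < j)%N -> forall u : rat, n i * n j <> u ^+ 2.
  move=> ij u e.
  have [Xi [Yi [gi [ei h1 h2 h3]]]] :=
    good_multiple (mult_seq_gt0 i) (mult_seq_in_ker2 i).
  have [Xj [Yj [gj [ej k1 k2 k3]]]] :=
    good_multiple (mult_seq_gt0 j) (mult_seq_in_ker2 j).
  have qi0 := param_BC_gt0 Xi; have qj0 := param_BC_gt0 Xj.
  have [p pp op] := not_sqr_oddv qi0 (param_BC_not_square h2 h3).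
  have kp : ~~ pint p Xj.
    have : in_ker p (pt (gen *+ mult_seq j + gen *+ mult_seq j)).
      rewrite -mulr2n; apply: (shifted_in_kerMn _ pp).
      by apply: (mult_seq_in_ker ij pp); rewrite /BC_mult ei.
    by rewrite ej.
  have ep := param_BC_even k3 pp kp.
  have : oddv p (param_BC Xi * param_BC Xj) = true.
    by rewrite (oddvM p (lt0r_neq0 qi0) (lt0r_neq0 qj0)) op ep.
  have ai := param_a_neq0 h2 h3; have aj := param_a_neq0 k2 k3.
  have -> : param_BC Xi * param_BC Xj =
            (u / (6 * (6 * gi / (Xi - 18)) * (6 * gj / (Xj - 18)))) ^+ 2.
    rewrite expr_div_n -e /n /t_mult ei ej [abscissa _]/= [abscissa _]/=.
    rewrite (param_nE h2 h3) (param_nE k2 k3).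
    exact: (cancel_squares _ _ (isT : (6 : rat) != 0) ai aj).
  by rewrite oddv_sqr.
have iso_sqr i j : wcurve_iso (congruent_curve (n i)) (congruent_curve (n j)) ->
    exists u, n i * n j = u ^+ 2.
  have npos k : 0 < n k.
    have [X [Y [g [e h1 h2 h3]]]] :=
      good_multiple (mult_seq_gt0 k) (mult_seq_in_ker2 k).
    by rewrite /n /t_mult e [abscissa _]/=; exact: (param_n_gt0 h2 h3).
  exact: congruent_iso_sqr (npos i) (npos j).
move=> i j nij /iso_sqr[u e].
have [l|l|/nij//] := ltngtP i j; first exact: main l u e.
by apply: (main _ _ l u); rewrite mulrC.
Qed.
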